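(* Let $G$ be a group of order $2^n$ with $n\geq 1$. Then: (1) if $1\leq n\leq 3$, then $G$ is DS; (2) if $n=4$, then $G$ is Cay-DS if and only if $G$ is isomorphic to $C_2\times Q_8=\langle a,b,c\mid c^2=1,\ a^2=b^2=b^{-2},\ a^{-1}ba=b^{-1},\ ac=ca,\ bc=cb\rangle$ or to $\langle a,b,c\mid a^2=b^2=c^4=1,\ ac=ca,\ bc=cb,\ c^2=(ba)^2\rangle$ (a group of the form $(C_4\times C_2):C_2$); (3) if $n\geq 5$, then $G$ is not Cay-DS.
   Context: For a finite group $G$ and a subset $S\subseteq G\setminus\{1\}$ with $S=S^{-1}$, the Cayley graph $Cay(G,S)$ has vertex set $G$, with $a,b$ adjacent iff $ab^{-1}\in S$. The spectrum of a graph is the multiset of eigenvalues of its adjacency matrix. A finite group $G$ is DS if every Cayley graph $\Gamma$ on $G$ is isomorphic to every (finite simple) graph $\Gamma'$ with the same spectrum; $G$ is Cay-DS if every Cayley graph $\Gamma$ on $G$ is isomorphic to every Cayley graph $\Gamma'$ (on any finite group) with the same spectrum. $Q_8$ is the quaternion group of order $8$. *)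

(* Defs.v *)
From HB Require Import structures.
From mathcomp Require Import all_boot all_order all_fingroup all_algebra.
From mathcomp Require Import all_solvable all_field.

Set Implicit Arguments.
Unset Strict Implicit.
Unset Printing Implicit Defensive.

Import GroupScope GRing.Theory.

Definition simple_graph (T : finType) (e : rel T) : Prop :=
  symmetric e /\ irreflexive e.

Definition graph_iso (T T' : finType) (e : rel T) (e' : rel T') : Prop :=
  exists2 f : T -> T', bijective f & forall x y, e' (f x) (f y) = e x y.

Definition adjacency_mx (T : finType) (e : rel T) : 'M[algC]_#|T| :=
  (\matrix_(i, j) (e (enum_val i) (enum_val j))%:R)%R.

(* The eigenvalues are algebraic over the rationals, so algC contains them    *)
(* all; they are listed with their multiplicity as roots of char_poly, and    *)
(* the list is meaningful only up to permutation.                             *)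
Definition spectrum (T : finType) (e : rel T) : seq algC :=
  sval (closed_field_poly_normal (char_poly (adjacency_mx e))).

Definition cospectral (T T' : finType) (e : rel T) (e' : rel T') : Prop :=
  perm_eq (spectrum e) (spectrum e').

Definition connection_set (gT : finGroupType) (S : {set gT}) : Prop :=
  1 \notin S /\ S^-1 = S.

Definition cayley (gT : finGroupType) (S : {set gT}) : rel gT :=
  fun a b => a * b^-1 \in S.

Definition DS (gT : finGroupType) : Prop :=
  forall S : {set gT}, connection_set S ->
  forall (T : finType) (e : rel T), simple_graph e ->
  cospectral (cayley S) e -> graph_iso (cayley S) e.

Definition Cay_DS (gT : finGroupType) : Prop :=
  forall S : {set gT}, connection_set S ->
  forall (hT : finGroupType) (S' : {set hT}), connection_set S' ->
  cospectral (cayley S) (cayley S') -> graph_iso (cayley S) (cayley S').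

Definition C2xQ8 : finGroupType := ('Z_2 * 'Q_8)%type.

Lemma char_poly_spectrum (T : finType) (e : rel T) :
  char_poly (adjacency_mx e) = (\prod_(z <- spectrum e) ('X - z%:P))%R.
Proof.
rewrite /spectrum; case: closed_field_poly_normal => r /= {1}->.
by rewrite (monicP (char_poly_monic _)) scale1r.
Qed.

Lemma mem_spectrum (T : finType) (e : rel T) z :
  (z \in spectrum e) = eigenvalue (adjacency_mx e) z.
Proof. by rewrite eigenvalue_root_char char_poly_spectrum root_prod_XsubC. Qed.

Lemma size_spectrum (T : finType) (e : rel T) : size (spectrum e) = #|T|.
Proof.
have:= size_char_poly (adjacency_mx e).
by rewrite char_poly_spectrum size_prod_XsubC => -[].
Qed.

Lemma cayley_simple (gT : finGroupType) (S : {set gT}) :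
  connection_set S -> simple_graph (cayley S).
Proof.
case=> S1 SV; split=> [a b|a]; rewrite /cayley; last by rewrite mulgV (negPf S1).
by rewrite -{1}SV mem_invg invMg invgK.
Qed.

Lemma Grp_C2xQ8 :
  [set: C2xQ8] \isog Grp (a : b : c :
    c ^+ 2 = 1, a ^+ 2 = b ^+ 2 = b ^- 2, a^-1 * b * a = b^-1,
    a * c = c * a, b * c = c * b).
Proof.
have GrpQ : 'Q_8 \isog Grp (x : y : x ^+ 4, y ^+ 2 = x ^+ 2, x ^ y = x^-1).
  exact: (@Grp_quaternion 3).
have intro_hom (rT : finGroupType) (B : {set rT}) a b c :
    <[a]> <*> <[b]> <*> <[c]> = B -> c ^+ 2 = 1 -> a ^+ 2 = b ^- 2 ->
    b ^+ 2 = b ^- 2 -> a^-1 * b * a = b^-1 -> a * c = c * a -> b * c = c * b ->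
  B \homg Grp (a : b : c :
    c ^+ 2 = 1, a ^+ 2 = b ^+ 2 = b ^- 2, a^-1 * b * a = b^-1,
    a * c = c * a, b * c = c * b).
- move=> defB c2 ab2 bb ba ac bc; apply/existsP; exists (a, b, c) => /=.
  by rewrite !xpair_eqE defB c2 ab2 ba bc ac !eqxx -bb !eqxx.
apply: (@intro_isoGrp _ [set: C2xQ8]%G).
  have /existsP[[x y] /eqP[defQ x4 y2 xy]] := isoGrp_hom GrpQ.
  have Z2 : (Zp1 : 'Z_2) ^+ 2 = 1 by apply/val_inj.
  pose i1 := [morphism of @pairg1 'I_2 (quaternion_gtype 8)].
  pose i2 := [morphism of @pair1g 'I_2 (quaternion_gtype 8)].
  have defG : <[i2 y]> <*> <[i2 x]> <*> <[i1 Zp1]> = [set: C2xQ8].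
    apply/eqP; rewrite eqEsubset subsetT /=; apply/subsetP=> -[z q] _.
    have -> : (z, q) = i2 q * i1 z by congr (_, _); rewrite ?mul1g ?mulg1.
    apply: groupM.
      have: i2 q \in i2 @* (<[x]> <*> <[y]>).
        by rewrite mem_morphim ?inE // defQ inE.
      rewrite morphimY ?subsetT // !morphim_cycle ?inE //.
      by apply: (subsetP _); rewrite joingC joing_subl.
    have: i1 z \in i1 @* <[Zp1]> by rewrite mem_morphim ?inE -?Zp_cycle ?inE.
    by rewrite morphim_cycle ?inE //; apply: (subsetP _); rewrite joing_subr.
  have x2V : x ^- 2 = x ^+ 2 by apply/eqP; rewrite eq_invg_mul -expgD x4.
  have c2 : i1 Zp1 ^+ 2 = 1 by rewrite -morphX ?inE // Z2 morph1.
  have ab2 : i2 y ^+ 2 = i2 x ^- 2.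
    by rewrite -!morphX ?inE // -morphV ?inE // y2 x2V.
  have bb : i2 x ^+ 2 = i2 x ^- 2.
    by rewrite -!morphX ?inE // -morphV ?inE // x2V.
  have ba : (i2 y)^-1 * i2 x * i2 y = (i2 x)^-1.
    by rewrite -mulgA -conjgE -morphJ ?inE // xy morphV ?inE.
  have i12 q : i2 q * i1 Zp1 = i1 Zp1 * i2 q.
    by congr (_, _); rewrite ?mul1g ?mulg1.
  apply: (intro_hom _ _ (i2 y) (i2 x) (i1 Zp1)) => //; exact: i12.
move=> hT H /existsP[[[a b] c] /eqP[defH c2 ab2 bb ba ac bc]].
have homK : (<[b]> <*> <[a]>)%G \homg 'Q_8.
  rewrite GrpQ; apply/existsP; exists (b, a) => /=; rewrite !xpair_eqE eqxx /=.
  rewrite conjgE mulgA ba ab2 -bb !eqxx !andbT.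
  by rewrite (expgD b 2 2) {1}bb mulVg.
have homC : <[c]>%G \homg [set: 'I_2].
  have oc : #[c] %| #[Zp1 : 'I_2] by rewrite order_Zp1 order_dvdn c2.
  by rewrite Zp_cycle; apply/homgP; exists (eltm_morphism oc); rewrite im_eltm.
have [f fE] := homgP homK; have [g gE] := homgP homC.
have cfg q z : commute (f q) (g z).
  apply: (centsP (A := <[b]> <*> <[a]>) (B := <[c]>)).
  - rewrite join_subG !cycle_subG /= cent_cycle.
    by apply/andP; split; apply/cent1P; [exact: bc | exact: ac].
  - by rewrite -fE mem_morphim ?inE.
  - by rewrite -gE mem_morphim ?inE.
pose h (u : C2xQ8) := g u.1 * f u.2.
have hM : {in [set: C2xQ8] &, {morph h : u v / u * v}}.
  move=> u v _ _; rewrite /h !morphM ?inE //.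
  by rewrite -!mulgA; congr (_ * _); rewrite !mulgA; congr (_ * _); exact/esym/cfg.
apply/homgP; exists (Morphism hM); rewrite morphimEdom /=.
have sH : (<[b]> <*> <[a]>) * <[c]> = H.
  rewrite -norm_joinEl; first by rewrite /= -defH (joingC <[a]>).
  by apply: cents_norm; rewrite -fE -gE; apply/centsP=> _ /morphimP[q _ _ ->]
    _ /morphimP[z _ _ ->].
rewrite -{}sH -fE -gE; apply/setP=> w; apply/imsetP/mulsgP.
  case=> -[z q] _ ->; exists (f q) (g z); rewrite ?mem_morphim ?inE //.
  by rewrite /h /= cfg.
case=> _ _ /morphimP[q _ _ ->] /morphimP[z _ _ ->] ->.
by exists (z, q); rewrite ?inE // /h /= cfg.
Qed.

(* Main.v *)
Require Import Defs.
From mathcomp Require Import all_boot all_fingroup all_solvable.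
From mathcomp Require Import all_order all_algebra all_field ring.
From Stdlib Require BinNat Nnat.

(* Cospectrality means equality of the numbers of closed walks of each length, the traces
   of the powers of the adjacency matrices.

   (1) A graph cospectral to a k-regular graph is k-regular, since the all-ones vector then
   attains the largest eigenvalue k.  Up to complement, the regular graphs on 2, 4 or 8
   vertices have degree at most 3, and an enumeration shows that closed walks tell them
   apart.

   (2) A group of order 2^(k+1) is determined by a subgroup of index 2, the conjugation by
   an outer element g and the square of g, which gives the 14 groups of order 16.  Twelve of
   them carry a Cayley graph with a nonisomorphic cospectral mate: the 4 x 4 rook graph,
   whose mate is the Shrikhande graph on C4 x C4, or a graph of degree 7 with a mate on
   C8 x C2.  For the other two, every Cayley graph is compared with all Cayley graphs on 16
   vertices of degree at most 7, up to group automorphisms; equal closed walks always come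
   with an isomorphism.

   (3) A pair as in (2) for a subgroup of G gives one for G, by taking the product of the
   mate with a cyclic group.  A group of order 32 contains one of the twelve groups or is
   extraspecial of type 2^(1+4)_-; the latter has an elementary abelian quotient of order 16,
   in which the rook graph is pulled back. *)

Set Implicit Arguments.
Unset Strict Implicit.
Unset Printing Implicit Defensive.

Import GroupScope.

Section PowerSums.

Import GRing.Theory Num.Theory.
Local Open Scope ring_scope.

Lemma perm_eq_power_sums (R : numDomainType) (r r' : seq R) :
  (forall j, (j < size r + size r')%N ->
     \sum_(z <- r) z ^+ j = \sum_(z <- r') z ^+ j) -> perm_eq r r'.
Proof.
move=> eq_sum; apply/allP=> z zrr' /=.
pose s := rem z (undup (r ++ r')); pose p := \prod_(w <- s) ('X - w%:P).
have mem_s w : (w \in s) = (w != z) && (w \in r ++ r').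
  by rewrite mem_rem_uniq ?undup_uniq // inE mem_undup.
have size_p : (size p <= size r + size r')%N.
  rewrite size_prod_XsubC size_rem ?mem_undup // -size_cat prednK ?size_undup //.
  by case: (undup _) (mem_undup (r ++ r') z) => //; rewrite zrr'.
have horner_sum (t : seq R) :
    \sum_(w <- t) p.[w] = \sum_(i < size p) p`_i * \sum_(w <- t) w ^+ i.
  under eq_bigr do rewrite horner_coef.
  by rewrite exchange_big; apply: eq_bigr => i _; rewrite mulr_sumr.
have eq_horner : \sum_(w <- r) p.[w] = \sum_(w <- r') p.[w].
  rewrite !horner_sum; apply: eq_bigr => i _.
  by rewrite eq_sum // (leq_trans (ltn_ord i)).
have pz : p.[z] != 0.
  rewrite horner_prod prodf_seq_neq0; apply/allP=> w; rewrite mem_s => /andP[wz _].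
  by rewrite !hornerE subr_eq0 eq_sym.
have count_horner (t : seq R) : {subset t <= r ++ r'} ->
    \sum_(w <- t) p.[w] = p.[z] *+ count_mem z t.
  elim: t => [|w t IHt] st; first by rewrite big_nil.
  rewrite big_cons IHt => [|x xt]; last by rewrite st // inE xt orbT.
  rewrite /= mulrnDr; congr (_ + _); have [->|wz] := eqVneq w z => //=.
  by apply/eqP; rewrite -/(root p w) root_prod_XsubC mem_s wz st ?mem_head.
move/eqP: eq_horner; rewrite !count_horner => [|x|x].
- by move/eqP/(mulrIn pz)/eqP.
- by rewrite mem_cat orbC => ->.
by rewrite mem_cat => ->.
Qed.

End PowerSums.

Section Eigenvalues.

Import Order.TTheory GRing.Theory Num.Theory.
Local Open Scope ring_scope.
Local Open Scope sesquilinear_scope.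

Lemma char_poly_conj (R : comUnitRingType) n (P A : 'M[R]_n) :
  P \in unitmx -> char_poly (invmx P *m A *m P) = char_poly A.
Proof.
move=> Pu; rewrite /char_poly /char_poly_mx.
have -> : 'X%:M - map_mx polyC (invmx P *m A *m P) =
    map_mx polyC (invmx P) *m ('X%:M - map_mx polyC A) *m map_mx polyC P.
  rewrite mulmxBr mulmxBl !map_mxM; congr (_ - _).
  by rewrite -mulmxA -scalar_mxC mulmxA -map_mxM mulVmx // map_mx1 mul1mx.
by rewrite !det_mulmx mulrC mulrA -det_mulmx -map_mxM mulmxV // map_mx1 det1 mul1r.
Qed.

Lemma eigenvalue_norm_le (F : numFieldType) n (A : 'M[F]_n) (k z : F) :
  (forall j, \sum_i `|A i j| <= k) -> eigenvalue A z -> `|z| <= k.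
Proof.
move=> colA /eigenvalueP[v vA v0].
have [i0 vi0] : exists i0, v 0 i0 != 0 by apply/rV0Pn.
pose j := [arg max_(i > i0) `|v 0 i|]%O.
have vj i : `|v 0 i| <= `|v 0 j|.
  by rewrite /j; case: real_arg_maxP => [//|m _|m _ /(_ i isT)]; rewrite ?normr_real.
have vj_gt0 : 0 < `|v 0 j| by apply: lt_le_trans (vj i0); rewrite normr_gt0.
have /rowP/(_ j) := vA; rewrite !mxE -(ler_pM2r vj_gt0) -normrM => <-.
apply: le_trans (ler_norm_sum _ _ _) _; apply: le_trans (ler_wpM2r (ltW vj_gt0) (colA j)).
by rewrite mulr_suml; apply: ler_sum => i _; rewrite normrM mulrC ler_wpM2l.
Qed.

Variables (C : numClosedFieldType) (n : nat) (A : 'M[C]_n).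

Lemma char_poly_normalmx : A \is normalmx ->
  char_poly A = \prod_i ('X - (spectral_diag A 0 i)%:P).
Proof.
move/orthomx_spectralP=> AE; rewrite {1}AE char_poly_conj ?spectral_unit //.
rewrite char_poly_trig ?diag_mx_is_trig //.
by apply: eq_bigr => i _; rewrite mxE eqxx mulr1n.
Qed.

Lemma mxtrace_exp_normalmx j : A \is normalmx ->
  \tr (A ^+ j) = \sum_i spectral_diag A 0 i ^+ j.
Proof.
case: n A => [|m] B; first by rewrite /mxtrace !big_ord0.
move/orthomx_spectralP=> BE.
rewrite -[B in LHS](horner_mx_X B) -rmorphXn /= {1}BE horner_mx_uconjC ?spectral_unit //.
rewrite horner_mx_diag mxtrace_mulC mulmxA mulmxV ?spectral_unit // mul1mx.
by rewrite mxtrace_diag; apply: eq_bigr => i _; rewrite mxE hornerXn.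
Qed.

Lemma hermitian_form_max (k : C) (u : 'rV[C]_n) :
    A \is hermsymmx -> (forall z, eigenvalue A z -> `|z| <= k) ->
  (u *m A *m u ^t*) 0 0 = k * (u *m u ^t*) 0 0 -> u *m A = k *: u.
Proof.
move=> Aherm eigA; have Anorm := hermitian_normalmx Aherm.
set P := spectralmx A; set D := spectral_diag A.
have Pu : P \is unitarymx by exact: spectral_unitarymx.
have AE : A = P ^t* *m diag_mx D *m P.
  by rewrite -invmx_unitary //; exact/orthomx_spectralP.
have D_le i : D 0 i <= k.
  have Dreal := mxOverP (hermitian_spectral_diag_real Aherm) 0 i.
  apply: le_trans (real_ler_norm Dreal) (eigA _ _).
  rewrite eigenvalue_root_char char_poly_normalmx //.
  by rewrite rootE horner_prod (bigD1 i) //= !hornerE subrr mul0r.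
have [w uE] : exists w, u = w *m P.
  by exists (u *m P ^t*); rewrite -mulmxA -invmx_unitary // mulVmx ?mulmx1 ?spectral_unit.
have -> : (u *m A *m u ^t*) 0 0 = \sum_i D 0 i * `|w 0 i| ^+ 2.
  rewrite AE uE trmx_mul map_mxM !mulmxA !mulmxtVK // mxE.
  by apply: eq_bigr => i _; rewrite mul_mx_diag !mxE normCK mulrAC mulrC.
have -> : (u *m u ^t*) 0 0 = \sum_i `|w 0 i| ^+ 2.
  rewrite uE trmx_mul map_mxM mulmxA mulmxtVK // mxE.
  by apply: eq_bigr => i _; rewrite !mxE normCK.
move/esym/eqP; rewrite mulr_sumr -subr_eq0 -sumrB psumr_eq0 => [/allP wD0|i _]; last first.
  by rewrite -mulrBl mulr_ge0 ?subr_ge0 // exprn_ge0.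
rewrite AE {1}uE !mulmxA mulmxtVK // [in RHS]uE scalemxAl; congr (_ *m _).
apply/rowP=> i; rewrite mul_mx_diag !mxE mulrC.
have := wD0 i (mem_index_enum _); rewrite -mulrBl mulf_eq0 sqrf_eq0 normr_eq0 subr_eq0.
by case/orP=> /eqP => [->|->]; rewrite ?mulr0.
Qed.

End Eigenvalues.

(** * Spectra and closed walks *)

Fixpoint nwalks (T : finType) (e : rel T) j (x y : T) : nat :=
  if j is j'.+1 then \sum_(z | e x z) nwalks e j' z y else x == y.

Definition closed_walks (T : finType) (e : rel T) j : nat := \sum_x nwalks e j x x.

Definition regular (T : finType) (e : rel T) k := forall x, #|e x| = k.

Section Spectrum.

Import GRing.Theory Num.Theory.
Local Open Scope ring_scope.
Local Open Scope sesquilinear_scope.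

Implicit Types T : finType.

Lemma sum_enum_val T (V : nmodType) (F : T -> V) : \sum_x F x = \sum_(i < #|T|) F (enum_val i).
Proof. exact: reindex (onW_bij _ (enum_val_bij T)). Qed.

Lemma sum_adjacency_row T (e : rel T) i :
  \sum_j adjacency_mx e i j = #|e (enum_val i)|%:R.
Proof.
rewrite -sum1_card natr_sum [RHS]big_mkcond [RHS]sum_enum_val.
by apply: eq_bigr => j _; rewrite mxE -topredE /=; case: (e _ _).
Qed.

Lemma adjacency_exp T (e : rel T) j x y :
  (adjacency_mx e ^+ j) (enum_rank x) (enum_rank y) = (nwalks e j x y)%:R.
Proof.
elim: j x => [|j IHj] x /=; first by rewrite expr0 mxE (inj_eq enum_rank_inj).
rewrite exprS -mulmxE mxE [in RHS]big_mkcond natr_sum [RHS]sum_enum_val; apply: eq_bigr => i _.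
rewrite -[i in LHS]enum_valK IHj mxE !enum_rankK.
by case: (e _ _); rewrite ?mul1r ?mul0r.
Qed.

Lemma mxtrace_adjacency_exp T (e : rel T) j :
  \tr (adjacency_mx e ^+ j) = (closed_walks e j)%:R.
Proof.
rewrite natr_sum [RHS]sum_enum_val; apply: eq_bigr => i _.
by rewrite -adjacency_exp enum_valK.
Qed.

Lemma adjacency_hermsymmx T (e : rel T) :
  symmetric e -> adjacency_mx e \is hermsymmx.
Proof.
move=> es; apply: realsym_hermsym; last by apply/mxOverP=> i j; rewrite mxE realn.
by apply/is_hermitianmxP; rewrite expr0 scale1r; apply/matrixP=> i j; rewrite !mxE es.
Qed.

Lemma sum_spectrum_exp T (e : rel T) j : symmetric e ->
  \sum_(z <- spectrum e) z ^+ j = (closed_walks e j)%:R.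
Proof.
move=> /adjacency_hermsymmx/hermitian_normalmx An.
have spE : perm_eq (spectrum e) [seq spectral_diag (adjacency_mx e) 0 i | i : 'I_#|T|].
  apply: prod_XsubC_eq; rewrite -char_poly_spectrum char_poly_normalmx //.
  by rewrite big_map big_enum.
by rewrite (perm_big _ spE) big_map big_enum -mxtrace_exp_normalmx ?mxtrace_adjacency_exp.
Qed.

Lemma cospectral_card T T' (e : rel T) (e' : rel T') :
  cospectral e e' -> #|T| = #|T'|.
Proof. by move=> cos; rewrite -(size_spectrum e) (perm_size cos) size_spectrum. Qed.

Lemma cospectralP T T' (e : rel T) (e' : rel T') : symmetric e -> symmetric e' ->
  cospectral e e' <-> closed_walks e =1 closed_walks e'.
Proof.
move=> es es'; split=> [cos j|cwE].
  by apply/eqP; rewrite -(eqr_nat algC) -!sum_spectrum_exp // (perm_big _ cos).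
by apply: perm_eq_power_sums => j _; rewrite !sum_spectrum_exp // cwE.
Qed.

Lemma cospectral_of_walks T T' (e : rel T) (e' : rel T') :
    symmetric e -> symmetric e' ->
    (forall j, (j < #|T| + #|T'|)%N -> closed_walks e j = closed_walks e' j) ->
  cospectral e e'.
Proof.
move=> es es' cwE; apply: perm_eq_power_sums => j.
by rewrite !size_spectrum => ltj; rewrite !sum_spectrum_exp // cwE.
Qed.

Lemma closed_walks2 T (e : rel T) : symmetric e ->
  closed_walks e 2 = (\sum_x #|e x|)%N.
Proof.
move=> es; apply: eq_bigr => x _ /=; rewrite -sum1_card; apply: eq_bigr => y exy.
by rewrite (bigD1 x) 1?es //= eqxx big1 // => z /andP[_ /negPf->].
Qed.

Lemma eigenvalue_regular_le T (e : rel T) k z : symmetric e -> regular e k ->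
  eigenvalue (adjacency_mx e) z -> `|z| <= k%:R.
Proof.
move=> es ek; apply: eigenvalue_norm_le => j; rewrite -(ek (enum_val j)) -sum_adjacency_row.
by rewrite ler_sum // => i _; rewrite !mxE es normr_nat.
Qed.

(* The all-ones vector maximizes the quadratic form of the adjacency matrix, hence is
   an eigenvector. *)
Lemma cospectral_regular T T' (e : rel T) (e' : rel T') k :
  symmetric e -> symmetric e' -> regular e k -> cospectral e e' -> regular e' k.
Proof.
move=> es es' ek cos; set A := adjacency_mx e'; pose u : 'rV[algC]_#|T'| := const_mx 1.
have uA_row j : (u *m A) 0 j = #|e' (enum_val j)|%:R.
  rewrite -sum_adjacency_row mxE; apply: eq_bigr => i _.
  by rewrite !mxE mul1r es'.
have uAu : (u *m A *m u ^t*) 0 0 = k%:R * (u *m u ^t*) 0 0.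
  transitivity ((\sum_x #|e' x|)%:R : algC).
    rewrite mxE natr_sum [RHS]sum_enum_val; apply: eq_bigr => j _.
    by rewrite uA_row !mxE rmorph1 mulr1.
  rewrite -closed_walks2 // -((cospectralP es es').1 cos) closed_walks2 //.
  under eq_bigr do rewrite ek; rewrite sum_nat_const (cospectral_card cos) mxE.
  rewrite (eq_bigr (fun=> 1)) => [|i _]; last by rewrite !mxE rmorph1 mulr1.
  by rewrite sumr_const card_ord natrM mulrC.
have eigA z : eigenvalue A z -> `|z| <= k%:R.
  by rewrite -mem_spectrum -(perm_mem cos) mem_spectrum; apply: eigenvalue_regular_le.
have /rowP uA := hermitian_form_max (adjacency_hermsymmx es') eigA uAu.
move=> x; apply/eqP; have := uA (enum_rank x).
by rewrite uA_row enum_rankK !mxE mulr1 -(eqr_nat algC) => ->.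
Qed.

End Spectrum.

Definition graph_compl (T : finType) (e : rel T) : rel T :=
  fun x y => (x != y) && ~~ e x y.

Section Complement.

Import GRing.Theory Num.Theory.
Local Open Scope ring_scope.

Implicit Types T : finType.

Lemma graph_compl_simple T (e : rel T) : simple_graph e -> simple_graph (graph_compl e).
Proof. by case=> es ei; split=> [x y|x]; rewrite /graph_compl ?eqxx // eq_sym es. Qed.

Lemma graph_compl_regular T (e : rel T) k : irreflexive e ->
  regular e k -> regular (graph_compl e) (#|T| - k).-1.
Proof.
move=> ei ek x; rewrite -(cardC (e x)) ek addKn [in RHS](cardD1 x).
have -> : x \in [predC e x] by rewrite !inE -topredE /= ei.
by apply: eq_card => y; rewrite !inE /graph_compl -!topredE /= eq_sym.
Qed.

Lemma graph_iso_compl T T' (e : rel T) (e' : rel T') :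
  irreflexive e -> irreflexive e' ->
  graph_iso (graph_compl e) (graph_compl e') -> graph_iso e e'.
Proof.
move=> ei ei' [f bf fE]; exists f => // x y.
have := fE x y; rewrite /graph_compl (bij_eq bf).
by have [->|_] /= := eqVneq x y; rewrite ?ei ?ei' // => /negb_inj.
Qed.

Lemma adjacency_compl T (e : rel T) : irreflexive e ->
  adjacency_mx (graph_compl e) = const_mx 1 - (1%:M + adjacency_mx e).
Proof.
move=> ei; apply/matrixP=> i j; rewrite !mxE /graph_compl (inj_eq enum_val_inj).
have [->|_] := eqVneq i j; first by rewrite ei addr0 subrr.
by rewrite add0r; case: (e _ _); rewrite ?subrr ?subr0.
Qed.

Lemma exprD_const_mx (R : comNzRingType) n (B : 'M[R]_n) (b : R) j :
    const_mx 1 *m B = b *: const_mx 1 :> 'M_n ->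
    B *m const_mx 1 = b *: const_mx 1 :> 'M_n ->
  n%:R *: (const_mx 1 + B) ^+ j =
    n%:R *: B ^+ j + ((n%:R + b) ^+ j - b ^+ j) *: const_mx 1.
Proof.
set J := const_mx 1 => JB BJ.
have JJ : J *m J = n%:R *: J.
  apply/matrixP=> i k; rewrite !mxE mulr1 -[in RHS](card_ord n) -sumr_const.
  by apply: eq_bigr => l _; rewrite !mxE mulr1.
have JBj m : J *m B ^+ m = b ^+ m *: J.
  elim: m => [|m IHm]; first by rewrite !expr0 mulmx1 scale1r.
  by rewrite exprSr -mulmxE mulmxA IHm -scalemxAl JB scalerA exprSr.
elim: j => [|j IHj]; first by rewrite !expr0 subrr scale0r addr0.
rewrite exprS -mulmxE scalemxAr IHj mulmxDl !mulmxDr -!scalemxAr JJ BJ JBj !scalerA.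
rewrite mulmxE -exprS addrCA -!scalerDl; congr (_ + _); congr (_ *: _); rewrite !exprS; ring.
Qed.

Lemma mul_adjacency_const_mx T (e : rel T) k : regular e k ->
  adjacency_mx e *m const_mx 1 = k%:R *: const_mx 1 :> 'M_#|T|.
Proof.
move=> ek; apply/matrixP=> i j; rewrite !mxE mulr1 -(ek (enum_val i)) -sum_adjacency_row.
by apply: eq_bigr => l _; rewrite !mxE mulr1.
Qed.

Lemma mul_const_mx_adjacency T (e : rel T) k : symmetric e -> regular e k ->
  const_mx 1 *m adjacency_mx e = k%:R *: const_mx 1 :> 'M_#|T|.
Proof.
move=> es ek; apply: trmx_inj; rewrite trmx_mul linearZ /= !trmx_const.
have -> : (adjacency_mx e)^T = adjacency_mx e by apply/matrixP=> i j; rewrite !mxE es.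
exact: mul_adjacency_const_mx.
Qed.

Lemma mxtrace_exprN (R : pzRingType) n (A : 'M[R]_n) j :
  \tr ((- A) ^+ j) = (-1) ^+ j * \tr (A ^+ j).
Proof.
rewrite [in LHS]exprNn -signr_odd -[in RHS]signr_odd !mulr_sign.
by case: (odd j) => //=; rewrite raddfN.
Qed.

Lemma mxtrace_expr1D (R : pzRingType) n (A : 'M[R]_n) j :
  \tr ((1%:M + A) ^+ j) = \sum_(i < j.+1) \tr (A ^+ i) *+ 'C(j, i).
Proof.
rewrite addrC -[1%:M]/(1 : 'M_n) exprD1n raddf_sum.
by apply: eq_bigr => i _; rewrite raddfMn.
Qed.

Lemma cospectral_compl T T' (e : rel T) (e' : rel T') k :
    simple_graph e -> simple_graph e' -> regular e k -> cospectral e e' ->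
  cospectral (graph_compl e) (graph_compl e').
Proof.
move=> eS eS' ek cos; have ek' := cospectral_regular eS.1 eS'.1 ek cos.
have cTT' := cospectral_card cos.
have traceE (U : finType) (f : rel U) j : simple_graph f -> regular f k ->
    #|U|%:R * (closed_walks (graph_compl f) j)%:R = #|U|%:R *
      ((-1) ^+ j * \sum_(i < j.+1) (closed_walks f i)%:R *+ 'C(j, i)
       + ((#|U|%:R - (1 + k%:R)) ^+ j - (- (1 + k%:R)) ^+ j)) :> algC.
  move=> [fs fi] fk; set A := adjacency_mx f; pose J : 'M[algC]_#|U| := const_mx 1.
  have JB : J *m - (1%:M + A) = - (1 + k%:R) *: J.
    by rewrite mulmxN mulmxDr mulmx1 (mul_const_mx_adjacency fs fk) scaleNr scalerDl scale1r.
  have BJ : - (1%:M + A) *m J = - (1 + k%:R) *: J.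
    by rewrite mulNmx mulmxDl mul1mx (mul_adjacency_const_mx fk) scaleNr scalerDl scale1r.
  rewrite -mxtrace_adjacency_exp adjacency_compl // -mxtraceZ (exprD_const_mx j JB BJ).
  rewrite mxtraceD !mxtraceZ mxtrace_exprN mxtrace_expr1D mulrDr; congr (_ * (_ * _) + _).
    by apply: eq_bigr => i _; rewrite mxtrace_adjacency_exp.
  rewrite mulrC; congr (_ * _); rewrite /mxtrace (eq_bigr (fun=> 1)) => [|i _].
    by rewrite sumr_const card_ord.
  by rewrite mxE.
have [cS cS'] := (graph_compl_simple eS, graph_compl_simple eS').
apply: (cospectral_of_walks cS.1 cS'.1) => j ltj; apply/eqP; rewrite -(eqr_nat algC).
have T_neq0 : #|T|%:R != 0 :> algC by rewrite pnatr_eq0; case: #|T| cTT' ltj => [<-|].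
apply/eqP/(mulfI T_neq0); rewrite traceE // [in RHS]cTT' traceE // cTT'.
congr (_ * (_ * _ + _)); apply: eq_bigr => i _.
by rewrite ((cospectralP eS.1 eS'.1).1 cos).
Qed.

(* Cospectral regular graphs have the same degree k, and one of k and |T| - 1 - k is less
   than |T| / 2. *)
Lemma graph_iso_cospectral_regular T T' (e : rel T) (e' : rel T') k :
    (0 < #|T|)%N -> simple_graph e -> simple_graph e' -> regular e k -> cospectral e e' ->
    (k.*2 < #|T| -> graph_iso e e')%N ->
    ((#|T| - k).-1.*2 < #|T| -> cospectral (graph_compl e) (graph_compl e') ->
       graph_iso (graph_compl e) (graph_compl e'))%N ->
  graph_iso e e'.
Proof.
move=> T_gt0 eS eS' ek cos low high; have [/low//|lek] := ltnP k.*2 #|T|.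
apply: (graph_iso_compl eS.2 eS'.2); apply: high; last exact: cospectral_compl ek cos.
have: ((#|T| - k).*2 <= #|T|)%N by rewrite doubleB leq_subLR -[#|T|.*2]addnn leq_add2r.
by case: (_ - k)%N => [//|m] /ltnW.
Qed.

End Complement.

(** * Graph embeddings *)

Definition component_embedding (T T' : finType) (e : rel T) (e' : rel T') (f : T -> T') :=
  [/\ injective f, forall x y, e' (f x) (f y) = e x y
    & forall x y', e' (f x) y' -> exists y, y' = f y].

(* Six times the number of complete subgraphs on four vertices through u. *)
Definition K4_count (T : finType) (e : rel T) u :=
  \sum_(x | e u x) \sum_(y | e u y) \sum_(z | e u z) [&& e x y, e x z & e y z].

Section ComponentEmbedding.

Variables (T T' : finType) (e : rel T) (e' : rel T') (f : T -> T').
Hypothesis fP : component_embedding e e' f.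

Lemma sum_neighbours_embedding x (F : T' -> nat) :
  \sum_(y' | e' (f x) y') F y' = \sum_(y | e x y) F (f y).
Proof.
have [f_inj fE f_closed] := fP; rewrite -(big_imset F (in2W f_inj)) /=.
apply: eq_bigl => y'; apply/idP/imsetP => [exy'|[y exy ->]]; last by rewrite fE.
by have [y yE] := f_closed x y' exy'; exists y; rewrite // -topredE /= -fE -yE.
Qed.

Lemma nwalks_embedding j x y : nwalks e' j (f x) (f y) = nwalks e j x y.
Proof.
elim: j x => [|j IHj] x /=; first by have [f_inj _ _] := fP; rewrite (inj_eq f_inj).
by rewrite sum_neighbours_embedding; apply: eq_bigr => z _; apply: IHj.
Qed.

Lemma K4_count_embedding u : K4_count e' (f u) = K4_count e u.
Proof.
have [_ fE _] := fP; rewrite /K4_count sum_neighbours_embedding.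
apply: eq_bigr => x _; rewrite sum_neighbours_embedding; apply: eq_bigr => y _.
by rewrite sum_neighbours_embedding; apply: eq_bigr => z _; rewrite !fE.
Qed.

Lemma component_embedding_simple : simple_graph e' -> simple_graph e.
Proof.
by have [_ fE _] := fP; case=> es ei; split=> [x y|x]; rewrite -!fE; [apply: es | apply: ei].
Qed.

Lemma component_embedding_iso : #|T| = #|T'| -> graph_iso e e'.
Proof. by have [f_inj fE _] := fP => cT; exists f => //; apply: inj_card_bij; rewrite ?cT. Qed.

End ComponentEmbedding.

Section GraphIso.

Implicit Types T : finType.

Lemma graph_iso_embedding T T' (e : rel T) (e' : rel T') : graph_iso e e' ->
  exists2 f, bijective f & component_embedding e e' f.
Proof.
case=> f bf fE; exists f => //; split=> // [|x y' _]; first exact: bij_inj.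
by have [g _ gK] := bf; exists (g y'); rewrite gK.
Qed.

Lemma graph_iso_sym T T' (e : rel T) (e' : rel T') : graph_iso e e' -> graph_iso e' e.
Proof.
case=> f [g fK gK] fE; exists g; first by exists f.
by move=> x y; rewrite -fE !gK.
Qed.

Lemma graph_iso_trans T1 T2 T3 (e1 : rel T1) (e2 : rel T2) (e3 : rel T3) :
  graph_iso e1 e2 -> graph_iso e2 e3 -> graph_iso e1 e3.
Proof.
case=> f bf fE [g bg gE]; exists (g \o f); first exact: bij_comp.
by move=> x y; rewrite /= gE fE.
Qed.

Lemma graph_iso_closed_walks T T' (e : rel T) (e' : rel T') j : graph_iso e e' ->
  closed_walks e j = closed_walks e' j.
Proof.
case/graph_iso_embedding=> f bf fP; rewrite /closed_walks [RHS](reindex f (onW_bij _ bf)).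
by apply: eq_bigr => x _; rewrite (nwalks_embedding fP).
Qed.

Lemma graph_iso_cospectral T T' (e : rel T) (e' : rel T') :
  simple_graph e -> simple_graph e' -> graph_iso e e' -> cospectral e e'.
Proof.
move=> [es _] [es' _] iso_ee'; apply/(cospectralP es es') => j.
exact: graph_iso_closed_walks.
Qed.

Lemma graph_iso_simple T T' (e : rel T) (e' : rel T') :
  graph_iso e e' -> simple_graph e' -> simple_graph e.
Proof. by case/graph_iso_embedding=> f _; apply: component_embedding_simple. Qed.

End GraphIso.

(** * Computing with adjacency rows *)

(* Computations by call-by-value would evaluate has and && in full, hence search and the
   nested conditionals below. *)
Definition search (X : Type) (a : pred X) (s : seq X) := find a s < size s.

Lemma searchE (X : Type) (a : pred X) s : search a s = has a s.
Proof. by rewrite /search has_find. Qed.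

Definition row_rel (M : seq (seq bool)) : rel 'I_(size M) :=
  fun i j => nth false (nth [::] M i) j.

Section Walks.

Local Notation N := BinNat.N.t.
Local Notation to_nat := BinNat.N.to_nat.

Fixpoint dot (r : seq bool) (v : seq N) : N :=
  match r, v with
  | b :: r', x :: v' => if b then BinNat.N.add x (dot r' v') else dot r' v'
  | _, _ => BinNat.N.zero
  end.

Definition unit_vector n i : seq N :=
  [seq if j == i then BinNat.N.one else BinNat.N.zero | j <- iota 0 n].

Fixpoint walk_counts M i (v : seq N) l : seq N :=
  if l is l'.+1 then
    let v' := [seq dot r v | r <- M] in
    nth BinNat.N.zero v' i :: walk_counts M i v' l'
  else [::].

Definition closed_walks_at l M i := walk_counts M i (unit_vector (size M) i) l.

Definition closed_walks_rows l (M : seq (seq bool)) :=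
  foldr (fun i v => [seq BinNat.N.add c.1 c.2 | c <- zip (closed_walks_at l M i) v])
    (nseq l BinNat.N.zero) (iota 0 (size M)).

Lemma to_nat_dot r v :
  to_nat (dot r v) = \sum_(k < size v | nth false r k) to_nat (nth BinNat.N.zero v k).
Proof.
elim: r v => [|b r IHr] [|x v]; rewrite ?big_ord0 //=.
  by rewrite big1 // => k; rewrite nth_nil.
rewrite [RHS]big_mkcond big_ord_recl -big_mkcond -IHr /=; case: b => //.
by rewrite Nnat.N2Nat.inj_add.
Qed.

Lemma closed_walks_atE l M (i : 'I_(size M)) :
  [seq to_nat c | c <- closed_walks_at l M i] =
  [seq nwalks (@row_rel M) j i i | j <- iota 1 l].
Proof.
rewrite /closed_walks_at; have : size (unit_vector (size M) i) = size M.
  by rewrite size_map size_iota.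
have : forall k : 'I_(size M),
    to_nat (nth BinNat.N.zero (unit_vector (size M) i) k) = nwalks (@row_rel M) 0 k i.
  by move=> k; rewrite (nth_map 0) ?size_iota // nth_iota // add0n /= -val_eqE; case: eqP.
elim: l (unit_vector _ _) 0 => //= l IHl v j vE size_v; set v' := map _ _.
have v'E (k : 'I_(size M)) : to_nat (nth BinNat.N.zero v' k) = nwalks (@row_rel M) j.+1 k i.
  rewrite (nth_map [::]) // to_nat_dot size_v /=.
  by apply: eq_bigr => z _; rewrite vE.
by rewrite v'E (IHl _ j.+1) // size_map.
Qed.

Lemma closed_walks_rowsE l M :
  [seq to_nat c | c <- closed_walks_rows l M] =
  [seq closed_walks (@row_rel M) j | j <- iota 1 l].
Proof.
suff sumE s : [seq to_nat c | c <- foldr (fun i v => [seq BinNat.N.add c.1 c.2 |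
        c <- zip (closed_walks_at l M i) v]) (nseq l BinNat.N.zero) (map val s)] =
    [seq \sum_(i <- s) nwalks (@row_rel M) j i i | j <- iota 1 l].
  rewrite /closed_walks_rows -val_enum_ord sumE.
  by apply: eq_map => j; rewrite big_enum.
elim: s => [|i s IHs] /=.
  by rewrite map_nseq; elim: l 1%N => //= l IHl j; rewrite big_nil -IHl.
under [RHS]eq_map do rewrite big_cons.
have := closed_walks_atE l i; move: IHs; move: (foldr _ _ _) (closed_walks_at _ _ _).
elim: (iota 1 l) => [|j t IHt] [|a v] [|b w] //= [aE vE] [bE wE].
by rewrite Nnat.N2Nat.inj_add aE bE (IHt _ _ vE wE).
Qed.

End Walks.

Definition K4_count_rows (M : seq (seq bool)) i :=
  let N := [seq k <- iota 0 (size M) | nth false (nth [::] M i) k] in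
  sumn [seq sumn [seq count (fun z => [&& nth false (nth [::] M x) y,
      nth false (nth [::] M x) z & nth false (nth [::] M y) z]) N | y <- N] | x <- N].

Lemma K4_count_rowsE M (i : 'I_(size M)) :
  K4_count_rows M i = K4_count (@row_rel M) i.
Proof.
rewrite /K4_count_rows; set N := filter _ _.
have sumN (F : nat -> nat) : \sum_(k <- N) F k = \sum_(k | @row_rel M i k) F k.
  by rewrite big_filter -(big_mkord (nth false (nth [::] M i)) F) /index_iota subn0.
rewrite sumnE big_map sumN; apply: eq_bigr => x _.
rewrite sumnE big_map sumN; apply: eq_bigr => y _.
rewrite -sum1_count big_mkcond sumN; apply: eq_bigr => z _.
by rewrite /row_rel; case: ifP.
Qed.

Fixpoint agree (r r' : seq bool) (f : seq nat) :=
  match f, r with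
  | [::], _ => true
  | j :: f', b :: r1 => if eqb b (nth false r' j) then agree r1 r' f' else false
  | _, _ => false
  end.

(* Extends the partial isomorphism sending row i to row f_i by images of the rows of M. *)
Fixpoint iso_search (M M' : seq (seq bool)) f :=
  if M is r :: M1 then
    search (fun k => if agree r (nth [::] M' k) f then
                       if k \in f then false else iso_search M1 M' (rcons f k)
                     else false) (iota 0 (size M'))
  else true.

Lemma agreeP r r' f : agree r r' f ->
  forall j, j < size f -> nth false r j = nth false r' (nth 0 f j).
Proof.
elim: f r => [|k f IHf] [|b r] //=; case: ifP => // /(eqbP b _) bE /IHf rE [|j] //=.
exact: rE.
Qed.

Section IsoSearch.

Variables M M' : seq (seq bool).

Definition partial_iso (f : seq nat) :=
  [/\ uniq f, all (gtn (size M')) f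
    & forall i j, j < i < size f -> nth false (nth [::] M i) j =
        nth false (nth [::] M' (nth 0 f i)) (nth 0 f j)].

Lemma partial_iso_rcons f k : partial_iso f -> k < size M' -> k \notin f ->
  agree (nth [::] M (size f)) (nth [::] M' k) f -> partial_iso (rcons f k).
Proof.
move=> [f_uniq f_lt fE] ltk kf /agreeP kE; split.
- by rewrite rcons_uniq kf.
- by rewrite all_rcons f_lt andbT.
move=> i j; rewrite size_rcons => /andP[ltji]; rewrite ltnS leq_eqVlt.
case/predU1P=> [iE|lti].
  by rewrite iE in ltji *; rewrite kE // !nth_rcons ltnn eqxx ltji.
by rewrite !nth_rcons lti (ltn_trans ltji lti) fE // ltji.
Qed.

Lemma iso_search_extend f : partial_iso f -> size f <= size M ->
  iso_search (drop (size f) M) M' f ->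
  exists2 g, partial_iso g & size g = size M.
Proof.
have [n] := ubnP (size M - size f).
elim: n f => // n IHn f; rewrite ltnS => len fP; rewrite leq_eqVlt.
case/predU1P=> [fM|ltfM]; first by exists f.
rewrite (drop_nth [::]) //= searchE => /hasP[k]; rewrite mem_iota => /= ltk.
case: ifP => // kE; case: ifPn => // kf; rewrite -(size_rcons f k).
apply: IHn; rewrite ?size_rcons //; first by rewrite (leq_trans _ len) // ltn_sub2l.
exact: partial_iso_rcons.
Qed.

Lemma iso_searchP : simple_graph (@row_rel M) -> simple_graph (@row_rel M') ->
  size M = size M' -> iso_search M M' [::] -> graph_iso (@row_rel M) (@row_rel M').
Proof.
move=> [es ei] [es' ei'] szM; rewrite -[X in iso_search X _]drop0.
have nilP : partial_iso [::] by split=> // i j; rewrite ltn0 andbF.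
case/(iso_search_extend nilP (leq0n _)) => g [g_uniq /allP g_lt gE] size_g.
have g_lt_size (i : 'I_(size M)) : nth 0 g i < size M'.
  by apply: g_lt; rewrite mem_nth ?size_g.
pose f i := Ordinal (g_lt_size i); have f_inj : injective f.
  by move=> i j /(congr1 val)/eqP /=; rewrite nth_uniq ?size_g // => /eqP/val_inj.
exists f; first by apply: inj_card_bij; rewrite // !card_ord szM.
have fE (i j : 'I_(size M)) : j < i -> row_rel (f i) (f j) = row_rel i j.
  by move=> ltji; rewrite /row_rel gE // ltji size_g ltn_ord.
move=> i j; case: (ltngtP i j) => [ltij|ltji|/val_inj->]; last by rewrite ei ei'.
  by rewrite es es' fE.
exact: fE.
Qed.

End IsoSearch.

Definition simple_rows (M : seq (seq bool)) :=
  let I := iota 0 (size M) in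
  all (fun i => let r := nth [::] M i in
    ~~ nth false r i && all (fun j => nth false r j == nth false (nth [::] M j) i) I) I.

Lemma simple_rowsP M : simple_rows M -> simple_graph (@row_rel M).
Proof.
have mem_I (i : 'I_(size M)) : val i \in iota 0 (size M) by rewrite mem_iota /=.
move=> /allP simpleM; split=> [i j|i]; have /andP[] := simpleM _ (mem_I i).
  by move=> _ /allP/(_ _ (mem_I j))/eqP.
by rewrite /row_rel => /negPf->.
Qed.

Definition separated (K : eqType) (key : seq (seq bool) -> K) L L' :=
  all simple_rows L' &&
  let keys := map key L' in
  all (fun M => let i := index (key M) keys in
    if i < size keys then iso_search M (nth [::] L' i) [::] else true) L.

(* Rows with the same key are compared through the first entry of L' with this key. *)
Lemma separated_iso (K : eqType) (key : seq (seq bool) -> K) n L L' M M' :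
    separated key L L' -> {subset L' <= L} -> {in L, forall M, size M = n} ->
    M \in L -> M' \in L' -> simple_graph (@row_rel M) -> key M = key M' ->
  graph_iso (@row_rel M) (@row_rel M').
Proof.
case/andP=> /allP simpleL' /allP sep sub size_n LM L'M' simpleM keyE.
have key_lt : index (key M') (map key L') < size (map key L').
  by rewrite index_mem map_f.
pose M0 := nth [::] L' (index (key M') (map key L')).
have L'M0 : M0 \in L' by rewrite mem_nth // -(size_map key).
have iso_M0 M1 : M1 \in L -> simple_graph (@row_rel M1) -> key M1 = key M' ->
    graph_iso (@row_rel M1) (@row_rel M0).
  move=> LM1 simpleM1 key1; have := sep M1 LM1; rewrite /= key1 key_lt.
  apply: iso_searchP => //; first exact/simple_rowsP/simpleL'.
  by rewrite !size_n // sub.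
apply: graph_iso_trans (iso_M0 M LM simpleM keyE) (graph_iso_sym (iso_M0 M' _ _ _)) => //.
  exact: sub.
exact/simple_rowsP/simpleL'.
Qed.

(** * Enumeration of bit strings up to symmetry *)

Fixpoint leaves (bad : pred (seq bool)) n p :=
  if bad p then [::] else
  if n is n'.+1 then leaves bad n' (rcons p true) ++ leaves bad n' (rcons p false)
  else [:: p].

(* Compares p, a final part of q, with the reordering of q by s, as far as the entries of
   q go. *)
Fixpoint lex_lt (p q : seq bool) (s : seq nat) :=
  match p, s with
  | b :: p', j :: s' =>
    if onth q j is Some c then if eqb b c then lex_lt p' q s' else c else false
  | _, _ => false
  end.

Fixpoint differ (p q : seq bool) (s : seq nat) :=
  match p, s with
  | b :: p', j :: s' =>
    if onth q j is Some c then if eqb b c then differ p' q s' else true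
    else differ p' q s'
  | _, _ => false
  end.

Definition known_count (p : seq bool) b (r : seq nat) :=
  count (fun j => if onth p j is Some c then eqb c b else false) r.

(* A quota (r, b, m) allows at most m entries b at the places listed in r.  The reordering
   iv fixes the strings sought; of the reorderings of a string by the elements of L, only
   the lexicographically largest is kept. *)
Definition prunable (iv : seq nat) (quotas : seq (seq nat * bool * nat)) L p :=
  if search (fun t => t.2 < known_count p t.1.2 t.1.1) quotas then true else
  if differ p p iv then true else search (lex_lt p p) L.

Definition candidates iv quotas L := leaves (prunable iv quotas L) (size iv) [::].

Definition meets_quota (q : seq bool) (t : seq nat * bool * nat) :=
  count (fun j => nth false q j == t.1.2) t.1.1 <= t.2.

Lemma mem_leaves bad n p q : size q = n ->
  (forall i, ~~ bad (take i (p ++ q))) -> p ++ q \in leaves bad n p.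
Proof.
elim: n p q => [|n IHn] p [|b q] //=.
  by move=> _ /(_ (size p)); rewrite cats0 take_size => /negPf->; rewrite mem_head.
move=> [size_q] good; have := good (size p); rewrite take_size_cat // => /negPf->.
have := IHn (rcons p b) q size_q; rewrite cat_rcons => /(_ good).
by rewrite mem_cat; case: b {good} => ->; rewrite ?orbT.
Qed.

Lemma onth_take i (q : seq bool) j c : onth (take i q) j = Some c -> nth false q j = c.
Proof. by elim: q i j => [|x q IHq] [|i] [|j] //= => [[]|/IHq]. Qed.

Lemma known_count_take i q b r :
  known_count (take i q) b r <= count (fun j => nth false q j == b) r.
Proof.
apply: sub_count => j /=; case qj: (onth _ _) => [c|] //.
by rewrite (onth_take qj) eqbE.
Qed.

Lemma differ_take i k p q s : differ (take k p) (take i q) s ->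
  exists2 j, j < size s & nth false p j != nth false q (nth 0 s j).
Proof.
elim: p k s => [|b p IHp] [|k] [|j s] //=.
have tail : differ (take k p) (take i q) s -> exists2 j', j' < (size s).+1 &
    nth false (b :: p) j' != nth false q (nth 0 (j :: s) j').
  by case/IHp=> j' ltj' neq; exists j'.+1.
case qj: (onth _ _) => [c|//]; case: ifP => [//|/negbT]; rewrite eqbE => bc _.
by exists 0 => //=; rewrite (onth_take qj).
Qed.

Fixpoint bits_val (p : seq bool) :=
  if p is b :: p' then b * 2 ^ size p' + bits_val p' else 0.

Lemma bits_val_lt p : bits_val p < 2 ^ size p.
Proof.
elim: p => //= b p IHp; rewrite expnS mul2n -addnn.
by case: b; rewrite ?mul1n ?mul0n ?ltn_add2l // ltn_addl.
Qed.

Lemma lex_lt_take i k p q s : lex_lt (take k p) (take i q) s -> size p = size s ->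
  bits_val p < bits_val [seq nth false q j | j <- s].
Proof.
elim: p k s => [|b p IHp] [|k] [|j s] //=.
case qj: (onth _ _) => [c|] //; rewrite (onth_take qj).
case: ifP => [/(eqbP b _) ->|/(eqbP b _) bc] /[swap] -[sps].
  by move=> /IHp/(_ sps); rewrite size_map sps ltn_add2l.
move=> cT; rewrite cT in bc *; case: b bc => [/(_ erefl)//|_] /=.
rewrite mul0n mul1n size_map -sps add0n.
by apply: leq_trans (bits_val_lt p) _; apply: leq_addr.
Qed.

Section Orderly.

Variables (X : Type) (P : X -> Prop) (code : X -> seq bool).
Variables (iv : seq nat) (quotas : seq (seq nat * bool * nat)) (L : seq (seq nat)).
Hypothesis size_code : forall x, P x -> size (code x) = size iv.
Hypothesis action : forall x s, P x -> s \in L ->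
  exists2 y, P y & code y = [seq nth false (code x) j | j <- s].

Lemma exists_lex_max x : P x -> exists2 y, P y &
  forall i s, s \in L -> ~~ lex_lt (take i (code y)) (take i (code y)) s.
Proof.
have [k] := ubnP (2 ^ size iv - bits_val (code x)).
elim: k x => // k IHk x ltk Px.
have [|max] := boolP (has (fun s => bits_val (code x) <
    bits_val [seq nth false (code x) j | j <- s]) L).
  case/hasP=> s sL; have [y Py <-] := action Px sL => lt_val.
  apply: IHk (Py); apply: leq_trans (ltnSE ltk); apply: ltn_sub2l => //.
  by rewrite -(size_code Py) (leq_trans lt_val) // ltnW // bits_val_lt.
exists x => // i s sL; apply: contra max => /lex_lt_take lt; apply/hasP; exists s => //.
have [y Py yE] := action Px sL.
by apply: lt; rewrite (size_code Px) -(size_code Py) yE size_map.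
Qed.

Lemma exists_candidate x :
    (forall x i, P x -> i < size iv ->
       nth false (code x) (nth 0 iv i) = nth false (code x) i) ->
    (forall x, P x -> all (meets_quota (code x)) quotas) ->
  P x -> exists2 y, P y & code y \in candidates iv quotas L.
Proof.
move=> ivP quotaP /exists_lex_max[y Py max_y]; exists y => //.
rewrite -[code y]cat0s; apply: mem_leaves; first exact: size_code.
move=> i; rewrite cat0s /prunable !searchE.
have -> : has (lex_lt (take i (code y)) (take i (code y))) L = false.
  by apply/hasPn=> s /max_y.
case: hasP => [[t /(allP (quotaP y Py)) tP]|_].
  by rewrite ltnNge (leq_trans (known_count_take _ _ _ _) tP).
by case: ifP => // /differ_take[j ltj]; rewrite ivP // eqxx.
Qed.

End Orderly.

Definition rows_of (D : seq (seq nat)) (p : seq bool) :=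
  [seq [seq nth false p k | k <- r] | r <- D].

Lemma nth_rows_of D p i j : i < size D -> j < size (nth [::] D i) ->
  nth false (nth [::] (rows_of D p) i) j = nth false p (nth 0 (nth [::] D i) j).
Proof. by move=> lti ltj; rewrite (nth_map [::]) // (nth_map 0). Qed.

(** * Regular graphs on at most eight vertices *)

Lemma nth_allpairs (S T R : Type) (x0 : S) (y0 : T) (z0 : R) (f : S -> T -> R) s t i j :
  i < size s -> j < size t ->
  nth z0 [seq f x y | x <- s, y <- t] (i * size t + j) = f (nth x0 s i) (nth y0 t j).
Proof.
elim: s i => [|x s IHs] [|i] //= lti ltj; rewrite nth_cat size_map.
  by rewrite ltj (nth_map y0).
by rewrite mulSn -addnA ltnNge leq_addr addKn IHs.
Qed.

(* The entry (i, j) of an adjacency matrix of order n is bit number i * n + j. *)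
Definition entry_index n : seq (seq nat) :=
  [seq [seq i * n + j | j <- iota 0 n] | i <- iota 0 n].

Lemma size_entry_index n : size (entry_index n) = n.
Proof. by rewrite size_map size_iota. Qed.

Definition transposed_index n : seq (seq nat) :=
  [seq [seq j * n + i | j <- iota 0 n] | i <- iota 0 n].

Definition adjacent_swaps n : seq (seq nat) :=
  [seq iota 0 k ++ [:: k.+1, k & iota k.+2 (n - k.+2)] | k <- iota 0 n.-1].

Definition regular_quotas n k :=
  ([seq i * n + i | i <- iota 0 n], true, 0) ::
  flatten [seq [:: (r, true, k); (r, false, n - k)]
          | r <- entry_index n ++ transposed_index n].

Definition regular_candidates n k :=
  candidates (flatten (transposed_index n)) (regular_quotas n k)
    [seq [seq i * n + j | i <- t, j <- t] | t <- adjacent_swaps n].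

Definition regular_rows n k := [seq rows_of (entry_index n) p | p <- regular_candidates n k].

Lemma adjacent_swap_perm n t : t \in adjacent_swaps n -> perm_eq t (iota 0 n).
Proof.
case/mapP=> k; rewrite mem_iota add0n /= => ltk ->.
have nE : n = k + (n - k.+2).+2 by rewrite -!addSnnS subnKC //; case: n ltk.
by rewrite [in iota 0 n]nE iotaD perm_cat2l (perm_catCA [:: k.+1] [:: k]).
Qed.

Definition enumerates (T : finType) (s : seq T) := perm_eq s (enum T).

Lemma card_count (T : finType) (s : seq T) (A : pred T) : enumerates s ->
  #|A| = count A s.
Proof. by move=> /seq.permP sE; rewrite sE -size_filter cardE {1}/enum_mem enumT. Qed.

Section EdgeCode.

Local Open Scope nat_scope.

Variables (T : finType) (e : rel T) (x0 : T) (n : nat).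
Hypotheses (e_simple : simple_graph e) (cardT : #|T| = n).

Definition edge_code (s : seq T) := [seq e x y | x <- s, y <- s].

Lemma enumerates_size (s : seq T) : enumerates s -> size s = n.
Proof. by move/perm_size->; rewrite -cardE. Qed.

Lemma edge_codeE s i j : enumerates s -> i < n -> j < n ->
  nth false (edge_code s) (i * n + j) = e (nth x0 s i) (nth x0 s j).
Proof.
move/enumerates_size=> size_s lti ltj.
by rewrite -[in i * n]size_s (nth_allpairs x0 x0) ?size_s.
Qed.

Lemma size_edge_code s : enumerates s ->
  size (edge_code s) = size (flatten (transposed_index n)).
Proof.
by move/enumerates_size=> size_s; rewrite !size_allpairs size_s size_iota.
Qed.

Lemma edge_code_perm s t : enumerates s -> perm_eq t (iota 0 n) ->
  edge_code [seq nth x0 s i | i <- t] =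
  [seq nth false (edge_code s) k | k <- [seq i * n + j | i <- t, j <- t]].
Proof.
move=> sE tP; have t_lt i : i \in t -> i < n by rewrite (perm_mem tP) mem_iota.
rewrite map_allpairs /edge_code allpairs_mapl allpairs_mapr.
by apply/eq_in_allpairs=> i j /t_lt lti /t_lt ltj; rewrite edge_codeE.
Qed.

Lemma edge_code_sym s k : enumerates s -> k < size (flatten (transposed_index n)) ->
  nth false (edge_code s) (nth 0 (flatten (transposed_index n)) k) =
  nth false (edge_code s) k.
Proof.
move=> sE; rewrite size_allpairs size_iota => ltk.
have n_gt0 : 0 < n by case: n ltk.
have [lti ltj] : k %/ n < n /\ k %% n < n by rewrite ltn_divLR ?ltn_pmod.
have -> : nth 0 (flatten (transposed_index n)) k = (k %% n * n + k %/ n)%N.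
  rewrite [in LHS](divn_eq k n) -[in _ * n + _](size_iota 0 n).
  by rewrite (nth_allpairs 0 0) ?size_iota // !nth_iota.
by rewrite [in RHS](divn_eq k n) !edge_codeE // e_simple.1.
Qed.

Lemma count_edge_code s k i b : enumerates s -> regular e k -> i < n ->
  count (fun l => nth false (edge_code s) l == b) [seq i * n + j | j <- iota 0 n] =
  if b then k else n - k.
Proof.
move=> sE ek lti; rewrite count_map; set y := nth x0 s i; rewrite -(ek y).
have -> : (if b then #|e y| else n - #|e y|) = #|[pred z | e y z == b]|.
  case: b; first by apply: eq_card => z; rewrite inE eqb_id.
  rewrite -cardT -(cardC (e y)) addKn.
  by apply: eq_card => z; rewrite !inE eqbF_neg.
rewrite (card_count _ sE) -[in RHS](mkseq_nth x0 s) count_map enumerates_size //.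
by apply: eq_in_count => j; rewrite mem_iota /= => ltj; rewrite edge_codeE.
Qed.

Lemma edge_code_quotas s k : enumerates s -> regular e k ->
  all (meets_quota (edge_code s)) (regular_quotas n k).
Proof.
move=> sE ek; apply/andP; split.
  rewrite /meets_quota /= leqn0 count_map -leqn0 leqNgt -has_count; apply/hasPn=> i.
  by rewrite mem_iota /= => lti; rewrite edge_codeE // e_simple.2.
apply/allP=> t /flattenP[_ /mapP[r rP ->] tr].
suff cnt b : count (fun l => nth false (edge_code s) l == b) r = if b then k else n - k.
  by move: tr; rewrite /meets_quota !inE => /orP[] /eqP->; rewrite /= cnt.
move: rP; rewrite mem_cat => /orP[] /mapP[i]; rewrite mem_iota /= => lti ->.
  exact: count_edge_code.
rewrite -(count_edge_code b sE ek lti) !count_map.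
apply: eq_in_count => j; rewrite mem_iota /= => ltj.
by rewrite !edge_codeE // e_simple.1.
Qed.

Lemma edge_code_iso s : enumerates s ->
  graph_iso (@row_rel (rows_of (entry_index n) (edge_code s))) e.
Proof.
move=> sE; have size_s := enumerates_size sE; set M := rows_of _ _.
have sizeM : size M = n by rewrite size_map size_entry_index.
apply: (@component_embedding_iso _ _ _ _ (fun i : 'I_(size M) => nth x0 s i)); last first.
  by rewrite card_ord sizeM.
have s_uniq : uniq s by rewrite (perm_uniq sE) enum_uniq.
split=> [i j /eqP|i j|i y _].
- by rewrite nth_uniq ?size_s -?sizeM // => /eqP/val_inj.
- have [lti ltj] : i < n /\ j < n by rewrite -sizeM.
  have rowE : nth [::] (entry_index n) i = [seq i * n + l | l <- iota 0 n].
    by rewrite (nth_map 0) ?size_iota // nth_iota.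
  rewrite /row_rel nth_rows_of ?rowE ?size_entry_index ?size_map ?size_iota //.
  by rewrite (nth_map 0) ?size_iota // nth_iota // edge_codeE.
have ys : y \in s by rewrite (perm_mem sE) mem_enum.
have lty : index y s < size M by rewrite sizeM -size_s index_mem.
by exists (Ordinal lty); rewrite nth_index.
Qed.

End EdgeCode.

Lemma regular_graph_iso_rows (T : finType) (e : rel T) k :
    simple_graph e -> regular e k -> 0 < #|T| ->
  exists2 M, M \in regular_rows #|T| k & graph_iso (@row_rel M) e.
Proof.
move=> eS ek /card_gt0P[x0 _]; set n := #|T|.
have [s sE codeC] : exists2 s, enumerates s & edge_code e s \in regular_candidates n k.
  apply: (@exists_candidate _ (@enumerates T) _ _ _ _ _ _ (enum T)).
  - by move=> s; apply: size_edge_code.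
  - move=> s _ sE /mapP[t /adjacent_swap_perm tP ->].
    exists [seq nth x0 s i | i <- t]; last exact: edge_code_perm.
    apply: perm_trans (sE); rewrite -[X in perm_eq _ X](mkseq_nth x0 s) perm_map //.
    by rewrite (enumerates_size (erefl n) sE).
  - by move=> s i; apply: edge_code_sym.
  - by move=> s sE; apply: edge_code_quotas.
  exact: perm_refl.
exists (rows_of (entry_index n) (edge_code e s)); first exact: map_f.
exact: edge_code_iso.
Qed.

Lemma regular_rows_separated :
  all (fun n => all (fun k => separated (closed_walks_rows 5) (regular_rows n k)
                                        (regular_rows n k)) (iota 0 (uphalf n)))
      [:: 2; 4; 8].
Proof. by vm_cast_no_check (erefl true). Qed.

Lemma cospectral_low_degree_iso (T T' : finType) (e : rel T) (e' : rel T') k :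
    #|T| \in [:: 2; 4; 8] -> k.*2 < #|T| -> simple_graph e -> simple_graph e' ->
    regular e k -> cospectral e e' ->
  graph_iso e e'.
Proof.
move=> cT ltk eS eS' ek cos; have ek' := cospectral_regular eS.1 eS'.1 ek cos.
have cTT' := cospectral_card cos.
have T_gt0 : 0 < #|T| by case: #|T| ltk.
have rowsE M : M \in regular_rows #|T| k -> size M = #|T|.
  by case/mapP=> p _ ->; rewrite size_map size_entry_index.
have [M LM isoM] := regular_graph_iso_rows eS ek T_gt0.
have [M' LM' isoM'] : exists2 M', M' \in regular_rows #|T| k & graph_iso (@row_rel M') e'.
  by rewrite cTT'; apply: regular_graph_iso_rows; rewrite -?cTT'.
have sep : separated (closed_walks_rows 5) (regular_rows #|T| k) (regular_rows #|T| k).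
  apply: (allP (allP regular_rows_separated _ cT)).
  by rewrite mem_iota gtn_uphalf_double.
apply: graph_iso_trans (graph_iso_sym isoM) (graph_iso_trans _ isoM').
apply: separated_iso sep _ rowsE LM LM' (graph_iso_simple isoM eS) _ => //.
apply: (inj_map Nnat.N2Nat.inj); rewrite !closed_walks_rowsE; apply: eq_map => j.
rewrite (graph_iso_closed_walks _ isoM) (graph_iso_closed_walks _ isoM').
exact: (cospectralP eS.1 eS'.1).1.
Qed.

Lemma cospectral_regular_iso (T T' : finType) (e : rel T) (e' : rel T') k :
    #|T| \in [:: 2; 4; 8] -> simple_graph e -> simple_graph e' -> regular e k ->
  cospectral e e' -> graph_iso e e'.
Proof.
move=> cT eS eS' ek cos; have T_gt0 : 0 < #|T| by case: #|T| cT.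
apply: (graph_iso_cospectral_regular T_gt0 eS eS' ek cos) => [ltk|ltk cosC].
  exact: cospectral_low_degree_iso ek cos.
apply: cospectral_low_degree_iso ltk _ _ (graph_compl_regular eS.2 ek) cosC => //.
  exact: graph_compl_simple.
exact: graph_compl_simple.
Qed.

(** * Polycyclic presentations *)

(* A pair (hs, n) for each generator g: its square is the element number n, and hs lists
   the numbers of the conjugates by g of the previous generators.  Elements are numbered
   by their position in words, where the generators have the numbers 1, 2, 4, ... *)
Definition pc_presentation := seq (seq nat * nat).

Section Words.

Local Open Scope nat_scope.

Variables (T : eqType) (mul : T -> T -> T) (one : T).

Definition words (gs : seq T) : seq T :=
  foldl (fun ws g => ws ++ [seq mul g x | x <- ws]) [:: one] gs.

(* The elements ws = words gs are an argument because they are shared by many tests. *)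
Definition pc_step ws gs (hn : seq nat * nat) g :=
  if mul g g == nth one ws hn.2 then
    all (gtn (size ws)) (hn.2 :: hn.1) &&
    all2 (fun p h => mul p g == mul g (nth one ws h)) gs hn.1
  else false.

Fixpoint pc_relations ps (d : pc_presentation) gs :=
  match d, gs with
  | hn :: d', g :: gs' => pc_step (words ps) ps hn g && pc_relations (rcons ps g) d' gs'
  | [::], [::] => true
  | _, _ => false
  end.

Definition pcgs d gs := pc_relations [::] d gs && uniq (words gs).

Lemma words_rcons gs g : words (rcons gs g) = words gs ++ [seq mul g x | x <- words gs].
Proof. by rewrite /words foldl_rcons. Qed.

Lemma size_words gs : size (words gs) = 2 ^ size gs.
Proof.
elim/last_ind: gs => // gs g IHgs.
by rewrite words_rcons size_cat size_map IHgs size_rcons expnS mul2n addnn.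
Qed.

Lemma words_cat gs gs' : exists ws, words (gs ++ gs') = words gs ++ ws.
Proof.
elim/last_ind: gs' => [|gs' g [ws IHgs']]; first by exists [::]; rewrite !cats0.
by rewrite -rcons_cat words_rcons IHgs' -!catA; eexists.
Qed.

Lemma nth_words_one gs : nth one (words gs) 0 = one.
Proof. by have [ws /= ->] := words_cat [::] gs. Qed.

Lemma pc_relations_rcons ps d gs hn g :
  pc_relations ps (rcons d hn) (rcons gs g) =
  pc_relations ps d gs && pc_step (words (ps ++ gs)) (ps ++ gs) hn g.
Proof.
elim: d gs ps => [|hn' d IHd] [|g' gs] ps /=; rewrite ?cats0 ?andbT ?andbF //.
- by case: gs => [|? ?]; rewrite andbF.
- by case: d {IHd} => [|? ?]; rewrite andbF.
by rewrite IHd cat_rcons andbA.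
Qed.

Lemma size_pcgs d gs : pc_relations [::] d gs -> size gs = size d.
Proof.
by elim: d gs [::] => [|hn d IHd] [|g gs] ps //= /andP[_ /IHd->].
Qed.

End Words.

Section MapWords.

Variables (T T' : eqType) (mul : T -> T -> T) (one : T) (mul' : T' -> T' -> T') (one' : T').
Variables (D : pred T) (phi : T -> T').
Hypotheses (D1 : D one) (DM : {in D &, forall x y, D (mul x y)}).
Hypotheses (phi1 : phi one = one') (phiM : {in D &, {morph phi : x y / mul x y >-> mul' x y}}).

Lemma words_closed gs : all D gs -> all D (words mul one gs).
Proof.
elim/last_ind: gs => [|gs g IHgs]; first by rewrite /= D1.
rewrite all_rcons words_rcons all_cat all_map => /andP[Dg /IHgs Dgs].
by rewrite Dgs; apply: sub_all Dgs => x Dx; apply: DM.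
Qed.

Lemma map_words gs : all D gs -> map phi (words mul one gs) = words mul' one' (map phi gs).
Proof.
elim/last_ind: gs => [|gs g IHgs]; first by rewrite /= phi1.
rewrite all_rcons map_rcons !words_rcons map_cat => /andP[Dg Dgs].
rewrite -(IHgs Dgs); congr (_ ++ _); rewrite -!map_comp; apply/eq_in_map=> x xgs.
by apply: phiM => //; apply: (allP (words_closed Dgs)).
Qed.

Hypothesis phi_inj : {in D &, injective phi}.

Lemma map_pc_step gs hn g : all D gs -> D g ->
  pc_step mul' one' (words mul' one' (map phi gs)) (map phi gs) hn (phi g) =
  pc_step mul one (words mul one gs) gs hn g.
Proof.
move=> Dgs Dg; have Dws := words_closed Dgs.
have D_nth k : D (nth one (words mul one gs) k).
  have [lt|ge] := ltnP k (size (words mul one gs)); last by rewrite nth_default.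
  by apply: (allP Dws); apply: mem_nth.
have phi_nth k : nth one' (words mul' one' (map phi gs)) k = phi (nth one (words mul one gs) k).
  rewrite -map_words //; have [lt|ge] := ltnP k (size (words mul one gs)).
    by rewrite (nth_map one).
  by rewrite !nth_default ?size_map ?phi1.
have phi_eq x y : D x -> D y -> (phi x == phi y) = (x == y) by apply: inj_in_eq.
rewrite /pc_step !size_words size_map phi_nth -phiM // phi_eq ?DM //.
case: ifP => // _; congr (_ && _).
move: (words mul' one' _) (words mul one _) D_nth phi_nth => ws' ws D_nth phi_nth.
elim: gs (hn.1) Dgs {Dws} => [|p gs IHgs] [|h hs] //= /andP[Dp Dgs].
rewrite phi_nth -(phiM Dp Dg) -(phiM Dg (D_nth h)) IHgs //.
by rewrite (phi_eq _ _ (DM Dp Dg) (DM Dg (D_nth h))).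
Qed.

Lemma map_pc_relations ps d gs : all D ps -> all D gs ->
  pc_relations mul' one' (map phi ps) d (map phi gs) = pc_relations mul one ps d gs.
Proof.
elim: d ps gs => [|hn d IHd] ps [|g gs] //= Dps /andP[Dg Dgs].
by rewrite map_pc_step // -map_rcons IHd // all_rcons Dg.
Qed.

Lemma map_pcgs d gs : all D gs -> pcgs mul' one' d (map phi gs) = pcgs mul one d gs.
Proof.
move=> Dgs; rewrite /pcgs (map_pc_relations (ps := [::])) // -map_words //.
rewrite map_inj_in_uniq // => x y xws yws; apply: phi_inj; exact: (allP (words_closed Dgs)).
Qed.

End MapWords.

Definition tmul (tb : seq (seq nat)) i j := nth 0 (nth [::] tb i) j.

Local Notation twords tb := (words (tmul tb) 0).
Local Notation gwords := (words mulg 1).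
Local Notation gpcgs := (pcgs mulg 1).

(* In a group generated by elements s_i and g with s_i ^ g = s_(sg_i), the products of the
   elements s_i and g * s_i satisfy s_i * (g * s_j) = g * (s_(sg_i) * s_j) and
   (g * s_i) * (g * s_j) = g ^+ 2 * s_(sg_i) * s_j. *)
Definition extend tb (hn : seq nat * nat) : seq (seq nat) :=
  let m := size tb in let sg := twords tb hn.1 in let row := nth [::] tb in
  [seq row i ++ map (addn m) (row (nth 0 sg i)) | i <- iota 0 m] ++
  [seq map (addn m) (row i) ++ row (tmul tb hn.2 (nth 0 sg i)) | i <- iota 0 m].

Definition pc_table (d : pc_presentation) := foldl extend [:: [:: 0]] d.

Lemma size_pc_table d : size (pc_table d) = (2 ^ size d)%N.
Proof.
elim/last_ind: d => // d hn IHd; rewrite /pc_table foldl_rcons size_cat !size_map size_iota.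
by rewrite -/(pc_table d) IHd size_rcons expnS mul2n addnn.
Qed.

Section Tables.

Variable gT : finGroupType.
Implicit Types (s gs : seq gT) (tb : seq (seq nat)) (d : pc_presentation).

Definition tabulates tb s :=
  all (all (gtn (size s))) tb /\
  [seq [seq nth 1 s k | k <- r] | r <- tb] = [seq [seq x * y | y <- s] | x <- s].

Lemma tabulates_size tb s : tabulates tb s -> size tb = size s.
Proof. by case=> _ /(congr1 size); rewrite !size_map. Qed.

Lemma tabulates_row tb s i : tabulates tb s -> i < size s ->
  all (gtn (size s)) (nth [::] tb i) /\
  [seq nth 1 s k | k <- nth [::] tb i] = [seq nth 1 s i * y | y <- s].
Proof.
move=> tbP lti; have size_tb := tabulates_size tbP; have [/allP tb_lt tbE] := tbP.
split; first by apply: tb_lt; rewrite mem_nth ?size_tb.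
by have := congr1 (nth [::] ^~ i) tbE; rewrite (nth_map [::]) ?size_tb // (nth_map 1).
Qed.

Lemma tabulates_mul tb s i j : tabulates tb s -> i < size s -> j < size s ->
  tmul tb i j < size s /\ nth 1 s (tmul tb i j) = nth 1 s i * nth 1 s j.
Proof.
move=> tbP lti ltj; have [/allP row_lt rowE] := tabulates_row tbP lti.
have size_row : size (nth [::] tb i) = size s.
  by rewrite -[RHS](size_map (mulg (nth 1 s i))) -rowE size_map.
split; first by apply: row_lt; rewrite mem_nth ?size_row.
by have := congr1 (nth 1 ^~ j) rowE; rewrite (nth_map 0) ?size_row // (nth_map 1).
Qed.

Section Images.

Variables (tb : seq (seq nat)) (gs : seq gT).
Hypothesis tbP : tabulates tb (gwords gs).

Local Notation s := (gwords gs).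
Local Notation m := (size s).

Lemma words_gt0 : 0 < m.
Proof. by rewrite size_words expn_gt0. Qed.

Lemma tmul_closed : {in gtn m &, forall i j, gtn m (tmul tb i j)}.
Proof. by move=> i j lti ltj; have [] := tabulates_mul tbP lti ltj. Qed.

Lemma tmul_morph : {in gtn m &, {morph nth 1 s : i j / tmul tb i j >-> i * j}}.
Proof. by move=> i j lti ltj; have [] := tabulates_mul tbP lti ltj. Qed.

Lemma twords_lt hs : all (gtn m) hs -> all (gtn m) (twords tb hs).
Proof. exact: (@words_closed _ _ 0 (gtn m) words_gt0 tmul_closed). Qed.

Lemma map_twords hs : all (gtn m) hs ->
  map (nth 1 s) (twords tb hs) = gwords (map (nth 1 s) hs).
Proof.
exact: (@map_words _ _ _ 0 mulg 1 (gtn m) _ words_gt0 tmul_closed (nth_words_one _ _ gs)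
  tmul_morph).
Qed.

Lemma map_twords_conj hs (g : gT) : all (gtn m) hs ->
  map (nth 1 s) hs = [seq p ^ g | p <- gs] ->
  map (nth 1 s) (twords tb hs) = [seq x ^ g | x <- s].
Proof.
move=> hs_lt hsE; rewrite map_twords // hsE.
rewrite (@map_words _ _ mulg 1 mulg 1 predT (conjg^~ g)) ?all_predT //.
  exact: conj1g.
by move=> x y _ _; apply: conjMg.
Qed.

Lemma nth_twords_conj hs (g : gT) i : all (gtn m) hs ->
    map (nth 1 s) hs = [seq p ^ g | p <- gs] -> i < m ->
  nth 0 (twords tb hs) i < m /\ nth 1 s (nth 0 (twords tb hs) i) = nth 1 s i ^ g.
Proof.
move=> hs_lt hsE lti; have sgE := map_twords_conj hs_lt hsE.
have lti_sg : i < size (twords tb hs).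
  by rewrite -(size_map (nth 1 s)) sgE size_map.
split; first by apply: (allP (twords_lt hs_lt)); apply: mem_nth.
by have := congr1 (nth 1 ^~ i) sgE; rewrite (nth_map 0) ?(nth_map 1).
Qed.

End Images.

Lemma pc_stepP gs hn g :
  reflect [/\ g * g = nth 1 (gwords gs) hn.2, hn.2 < size (gwords gs),
              all (gtn (size (gwords gs))) hn.1
            & map (nth 1 (gwords gs)) hn.1 = [seq p ^ g | p <- gs]]
          (pc_step mulg 1 (gwords gs) gs hn g).
Proof.
rewrite /pc_step; set s := gwords gs.
have -> : all2 (fun p h => p * g == g * nth 1 s h) gs hn.1 =
    (map (nth 1 s) hn.1 == [seq p ^ g | p <- gs]).
  by elim: gs hn.1 s => [|p gs' IHgs] [|h hs] s //=;
     rewrite IHgs eqseq_cons (conjgC p) (inj_eq (mulgI g)) eq_sym.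
case: eqP => [gg|gg]; last by constructor; case.
apply: (iffP andP) => [[/andP[ltn hs_lt] /eqP]|[_ ltn hs_lt ->]]; first by split.
by rewrite /= ltn hs_lt.
Qed.

Lemma tabulates_extend tb gs hn g : tabulates tb (gwords gs) ->
  pc_step mulg 1 (gwords gs) gs hn g -> tabulates (extend tb hn) (gwords (rcons gs g)).
Proof.
move=> tbP /pc_stepP[gg ltn hs_lt hsE]; set s := gwords gs in tbP gg ltn hs_lt hsE.
set m := size s; pose sg := nth 0 (twords tb hn.1).
have [sg_lt sgE] : (forall i, i < m -> sg i < m) /\
    forall i, i < m -> nth 1 s (sg i) = nth 1 s i ^ g.
  by split=> i lti; have [] := nth_twords_conj tbP hs_lt hsE lti.
have row_lt i : i < m -> all (gtn m) (nth [::] tb i) by move=> /(tabulates_row tbP)[].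
have rowE i : i < m -> map (nth 1 s) (nth [::] tb i) = [seq nth 1 s i * y | y <- s].
  by move=> /(tabulates_row tbP)[].
have [gsg_lt gsgE] : (forall i, i < m -> tmul tb hn.2 (sg i) < m) /\
    forall i, i < m -> nth 1 s (tmul tb hn.2 (sg i)) = g * nth 1 s i * g.
  split=> i lti; have [// ltgsg gsgE] := tabulates_mul tbP ltn (sg_lt i lti).
  by rewrite gsgE -gg sgE // conjgE !mulgA mulgK.
rewrite words_rcons /extend (tabulates_size tbP) -/s -/m -/sg; set s' := s ++ _.
have mem_m i : i \in iota 0 m -> i < m by rewrite mem_iota.
split.
  have lt_add r : all (gtn m) r -> all (gtn (size s')) r /\ all (gtn (size s')) (map (addn m) r).
    rewrite size_cat size_map => r_lt; rewrite all_map.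
    by split; apply: sub_all r_lt => i /= lti; rewrite ?ltn_add2l ?ltn_addr.
  rewrite all_cat !all_map; apply/andP; split; apply/allP=> i /mem_m lti; rewrite /= all_cat.
    by rewrite (lt_add _ (row_lt i lti)).1 (lt_add _ (row_lt _ (sg_lt i lti))).2.
  by rewrite (lt_add _ (row_lt i lti)).2 (lt_add _ (row_lt _ (gsg_lt i lti))).1.
have old r : all (gtn m) r -> map (nth 1 s') r = map (nth 1 s) r.
  by move/allP=> r_lt; apply/eq_in_map=> i /r_lt /= lti; rewrite nth_cat lti.
have new r : all (gtn m) r -> map (nth 1 s') (map (addn m) r) = map (mulg g) (map (nth 1 s) r).
  move/allP=> r_lt; rewrite -!map_comp; apply/eq_in_map=> i /r_lt /= lti.
  by rewrite nth_cat ltnNge leq_addr addKn (nth_map 1).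
rewrite map_cat -!map_comp [in RHS]map_cat -[in RHS]map_comp.
have map_s (F : gT -> seq gT) : map F s = [seq F (nth 1 s i) | i <- iota 0 m].
  by rewrite -[in LHS](mkseq_nth 1 s) -map_comp.
congr (_ ++ _); rewrite map_s; apply/eq_in_map=> i /mem_m lti /=.
  rewrite !map_cat old ?row_lt // new ?row_lt ?sg_lt // !rowE ?sg_lt // -!map_comp sgE //.
  by congr (_ ++ _); apply: eq_map => y; rewrite /= mulgA -conjgC mulgA.
rewrite !map_cat new ?row_lt // old ?row_lt ?gsg_lt // !rowE ?gsg_lt // -!map_comp gsgE //.
by congr (_ ++ _); apply: eq_map => y /=; rewrite !mulgA.
Qed.

Lemma pc_relations_tabulates_cat tb ps d gs : tabulates tb (gwords ps) ->
  pc_relations mulg 1 ps d gs -> tabulates (foldl extend tb d) (gwords (ps ++ gs)).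
Proof.
elim: d ps gs tb => [|hn d IHd] ps [|g gs] tb //= tbP; first by rewrite cats0.
by case/andP=> step; rewrite -cat_rcons; apply: IHd; apply: tabulates_extend.
Qed.

Lemma pc_relations_tabulates d gs : pc_relations mulg 1 [::] d gs ->
  tabulates (pc_table d) (gwords gs).
Proof.
by apply: pc_relations_tabulates_cat; split; rewrite //= mulg1.
Qed.

Lemma mem_words1 gs : 1 \in gwords gs.
Proof. by have := mem_nth 1 (words_gt0 gs); rewrite nth_words_one. Qed.

Lemma sub_words gs : {subset gs <= gwords gs}.
Proof.
elim/last_ind: gs => // gs g IHgs p; rewrite words_rcons mem_cat mem_rcons inE.
case/predU1P=> [->|/IHgs->//]; apply/orP; right; apply/mapP; exists 1; rewrite ?mulg1 //.
exact: mem_words1.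
Qed.

Lemma tabulates_group_set tb gs : tabulates tb (gwords gs) ->
  group_set [set x in gwords gs].
Proof.
move=> tbP; apply/group_setP; split.
  by rewrite inE mem_words1.
move=> x y; rewrite !inE => /(nthP 1)[i lti <-] /(nthP 1)[j ltj <-].
by have [ltij <-] := tabulates_mul tbP lti ltj; rewrite mem_nth.
Qed.

Lemma uniq_words_rcons gs g : group_set [set x in gwords gs] ->
  uniq (gwords (rcons gs g)) = uniq (gwords gs) && (g \notin gwords gs).
Proof.
move=> gP; pose H := Group gP; have memH x : (x \in gwords gs) = (x \in H) by rewrite inE.
rewrite words_rcons cat_uniq (map_inj_uniq (mulgI g)) andbCA.
case: (uniq _); rewrite ?andbF // !andbT; congr negb.
apply/hasP/idP => [[_ /mapP[x + ->] /=]|]; rewrite !memH; first by move/groupMr->.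
by move=> gH; exists g; rewrite ?memH //; apply/mapP; exists 1; rewrite ?mem_words1 ?mulg1.
Qed.

Fixpoint pc_solutions tb ps d : seq (seq nat) :=
  if d is hn :: d' then
    let ws := twords tb ps in
    [seq h :: hs | h <- [seq h <- iota 0 (size tb) |
                          if pc_step (tmul tb) 0 ws ps hn h then h \notin ws else false],
                   hs <- pc_solutions tb (rcons ps h) d']
  else [:: [::]].

Lemma mem_pc_solutions_cons tb ps hn d h hs :
  (h :: hs \in pc_solutions tb ps (hn :: d)) =
  [&& h < size tb, pc_step (tmul tb) 0 (twords tb ps) ps hn h, h \notin twords tb ps
    & hs \in pc_solutions tb (rcons ps h) d].
Proof.
apply/allpairsPdep/and4P => [[h' [hs' []]]|[lth step new hs_sol]].
  rewrite mem_filter mem_iota; case: ifP => // step /andP[new lth] + [-> ->].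
  by split.
by exists h, hs; rewrite mem_filter mem_iota step new.
Qed.

Section Solutions.

Variables (tb : seq (seq nat)) (gs : seq gT).
Hypotheses (tbP : tabulates tb (gwords gs)) (gs_uniq : uniq (gwords gs)).

Local Notation s := (gwords gs).
Local Notation m := (size s).

Lemma nth_words_inj : {in gtn m &, injective (nth 1 s)}.
Proof. by move=> i j lti ltj /eqP; rewrite nth_uniq // => /eqP. Qed.

Lemma mem_twords ps h : all (gtn m) ps -> h < m ->
  (h \in twords tb ps) = (nth 1 s h \in gwords (map (nth 1 s) ps)).
Proof.
move=> ps_lt lth; rewrite -(map_twords tbP) //; apply/idP/mapP => [h_ws|[k k_ws]].
  by exists h.
by move/nth_words_inj->; rewrite // inE; apply: (allP (twords_lt tbP ps_lt)).
Qed.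

Lemma pc_step_twords ps hn h : all (gtn m) ps -> h < m ->
  pc_step mulg 1 (gwords (map (nth 1 s) ps)) (map (nth 1 s) ps) hn (nth 1 s h) =
  pc_step (tmul tb) 0 (twords tb ps) ps hn h.
Proof.
exact: (@map_pc_step _ _ _ 0 mulg 1 (gtn m) _ (words_gt0 gs) (tmul_closed tbP)
  (nth_words_one _ _ gs) (tmul_morph tbP) nth_words_inj).
Qed.

Lemma mem_pc_solutions_cat d0 ps d hs : all (gtn m) ps -> gpcgs d0 (map (nth 1 s) ps) ->
  (hs \in pc_solutions tb ps d) =
  [&& all (gtn m) hs, pc_relations mulg 1 (map (nth 1 s) ps) d (map (nth 1 s) hs)
    & uniq (gwords (map (nth 1 s) (ps ++ hs)))].
Proof.
elim: d d0 ps hs => [|hn d IHd] d0 ps [|h hs] ps_lt /andP[psP ps_uniq] //=.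
- by rewrite cats0 ps_uniq.
- by rewrite andbF.
- by apply/allpairsPdep=> -[? [? [_ _]]].
rewrite mem_pc_solutions_cons (tabulates_size tbP); have [lth|//] := ltnP h m.
rewrite -pc_step_twords // mem_twords //; set g := nth 1 s h.
set qs := map (nth 1 s) ps in psP ps_uniq *.
case step: (pc_step _ _ _ qs hn g); last by rewrite /= andbF.
have psg_uniq := uniq_words_rcons g (tabulates_group_set (pc_relations_tabulates psP)).
have [g_ps|g_ps] := boolP (g \in gwords qs).
  apply/esym/negP=> /and3P[_ _]; rewrite -cat_rcons map_cat map_rcons -/qs -/g.
  have [ws ->] := words_cat mulg 1 (rcons qs g) (map (nth 1 s) hs).
  by rewrite cat_uniq psg_uniq g_ps andbF.
have rcons_lt : all (gtn m) (rcons ps h) by rewrite all_rcons ps_lt andbT.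
rewrite (IHd (rcons d0 hn)) ?map_rcons ?cat_rcons //.
by rewrite /pcgs pc_relations_rcons psP step psg_uniq ps_uniq.
Qed.

Lemma mem_pc_solutions d hs :
  (hs \in pc_solutions tb [::] d) = all (gtn m) hs && gpcgs d (map (nth 1 s) hs).
Proof. exact: (@mem_pc_solutions_cat [::]). Qed.

End Solutions.

End Tables.

(** * Groups of order at most 16 *)

(* Necessary conditions on the conjugates hs and the square n of a new generator: it
   commutes with its square n, its square acts by conjugation like n, and n is the least
   square in its coset. *)
Definition extension_ok tb hs n :=
  let sg := nth 0 (twords tb hs) in
  if sg n == n then
    all (fun i => (tmul tb i n == tmul tb n (sg (sg i))) &&
                  (n <= tmul tb n (tmul tb (sg i) i))) (iota 0 (size tb))
  else false.

Definition pc_extensions d : seq pc_presentation :=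
  let tb := pc_table d in
  [seq rcons d (hs, n) | hs <- pc_solutions tb [::] d,
                         n <- [seq n <- iota 0 (size tb) | extension_ok tb hs n]].

Definition extensions_contain (R R' : seq pc_presentation) :=
  all (fun d => all (fun d1 => let tb := pc_table d1 in
    search (fun d' => pc_solutions tb [::] d' != [::]) R') (pc_extensions d)) R.

Section Classification.

Variable gT : finGroupType.
Implicit Types (G H : {group gT}) (gs : seq gT) (d : pc_presentation).

Lemma lcoset_index2 H G g : H \subset G -> #|G : H| = 2 -> g \in G :\: H ->
  g *: H = G :\: H.
Proof.
move=> sHG iGH gGH; have /andP[_ /subsetP nHG] := index2_normal sHG iGH.
by rewrite -norm_rlcoset ?(rcoset_index2 sHG iGH gGH) ?nHG //; case/setDP: gGH.
Qed.

Lemma index2_square H G g : H \subset G -> #|G : H| = 2 -> g \in G :\: H -> g * g \in H.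
Proof.
move=> sHG iGH gGH; rewrite -groupV invMg -mem_rcoset (rcoset_index2 sHG iGH gGH).
by rewrite inE !groupV -in_setD.
Qed.

Lemma pcgs_conj d gs (g : gT) : gpcgs d [seq p ^ g | p <- gs] = gpcgs d gs.
Proof.
apply: (@map_pcgs _ _ _ _ _ _ predT) => //; rewrite ?all_predT //.
- exact: conj1g.
- by move=> x y _ _; apply: conjMg.
by move=> x y _ _; apply: conjg_inj.
Qed.

Section Extension.

Variables (G H : {group gT}) (d : pc_presentation) (gs : seq gT) (g : gT).
Hypotheses (sHG : H \subset G) (iGH : #|G : H| = 2).
Hypotheses (gsP : gpcgs d gs) (gsH : H =i gwords gs).
Hypothesis gGH : g \in G :\: H.

Local Notation s := (gwords gs).
Local Notation tb := (pc_table d).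

Definition conj_numbers := [seq index (p ^ g) s | p <- gs].

Definition square_number := index (g * g) s.

Let tbP : tabulates tb s.
Proof. by case/andP: gsP => /pc_relations_tabulates. Qed.

Let size_tb : size tb = size s := tabulates_size tbP.

Lemma index_words_lt x : x \in H -> index x s < size s.
Proof. by rewrite gsH index_mem. Qed.

Lemma nth_index_words x : x \in H -> nth 1 s (index x s) = x.
Proof. by rewrite gsH => /nth_index->. Qed.

Lemma conj_gens_closed p : p \in gs -> p ^ g \in H.
Proof.
move=> /sub_words; rewrite -gsH => pH; rewrite memJ_norm //.
have /andP[_ nHG] := index2_normal sHG iGH.
by apply: (subsetP nHG); case/setDP: gGH.
Qed.

Lemma conj_numbersE : map (nth 1 s) conj_numbers = [seq p ^ g | p <- gs].
Proof.
rewrite -map_comp; apply/eq_in_map=> p /conj_gens_closed.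
by move/nth_index_words.
Qed.

Lemma conj_numbers_lt : all (gtn (size s)) conj_numbers.
Proof. by apply/allP=> _ /mapP[p /conj_gens_closed pH ->]; apply: index_words_lt. Qed.

Lemma extension_step : pc_step mulg 1 s gs (conj_numbers, square_number) g.
Proof.
have ggH := index2_square sHG iGH gGH.
apply/pc_stepP; split=> /=; first by rewrite nth_index_words.
- exact: index_words_lt.
- exact: conj_numbers_lt.
exact: conj_numbersE.
Qed.

Lemma extension_pcgs :
  gpcgs (rcons d (conj_numbers, square_number)) (rcons gs g) /\ G =i gwords (rcons gs g).
Proof.
split; first have /andP[gsR gs_uniq] := gsP.
  rewrite /pcgs pc_relations_rcons gsR extension_step.
  rewrite (uniq_words_rcons g (tabulates_group_set tbP)) gs_uniq -gsH.
  by case/setDP: gGH.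
have mem_gH x : (x \in [seq g * y | y <- s]) = (x \in g *: H).
  by apply/mapP/lcosetP=> -[y ys ->]; exists y; rewrite // ?gsH // -gsH.
move=> x; rewrite words_rcons mem_cat mem_gH (lcoset_index2 sHG iGH gGH) -gsH inE.
by case: (boolP (x \in H)) => // /(subsetP sHG)->.
Qed.

Lemma extension_is_ok :
    (forall x, x \in G :\: H -> square_number <= index (x * x) s) ->
  extension_ok tb conj_numbers square_number.
Proof.
move=> g_min; have /andP[_ s_uniq] := gsP; have ggH := index2_square sHG iGH gGH.
have nth_inj := nth_words_inj s_uniq; pose sg := nth 0 (twords tb conj_numbers).
have [sg_lt sgE] : (forall i, i < size s -> sg i < size s) /\
    forall i, i < size s -> nth 1 s (sg i) = nth 1 s i ^ g.
  by split=> i lti; have [] := nth_twords_conj tbP conj_numbers_lt conj_numbersE lti.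
have [tlt tE] : (forall i j, i < size s -> j < size s -> tmul tb i j < size s) /\
    forall i j, i < size s -> j < size s -> nth 1 s (tmul tb i j) = nth 1 s i * nth 1 s j.
  by split=> i j lti ltj; have [] := tabulates_mul tbP lti ltj.
have ltn := index_words_lt ggH; have nE := nth_index_words ggH.
rewrite /extension_ok -/sg -/square_number.
have -> : sg square_number = square_number.
  by apply: nth_inj; rewrite ?inE ?sg_lt // sgE // nE conjgE mulgA mulKg.
rewrite eqxx; apply/allP=> i; rewrite mem_iota size_tb => /= lti; apply/andP; split.
  apply/eqP/nth_inj; rewrite ?inE ?tlt ?sg_lt // !tE ?sg_lt // !sgE ?sg_lt // nE.
  by rewrite -conjgM -conjgC.
rewrite -[X in _ <= X](index_uniq 1 _ s_uniq) ?tlt ?sg_lt //.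
rewrite !tE ?tlt ?sg_lt // sgE // nE.
have -> : g * g * (nth 1 s i ^ g * nth 1 s i) = g * nth 1 s i * (g * nth 1 s i).
  by rewrite conjgE !mulgA mulgK.
by apply: g_min; rewrite -(lcoset_index2 sHG iGH gGH) mem_lcoset mulKg gsH mem_nth.
Qed.

End Extension.

Lemma index2_pcgs_extension H G d gs :
    H \subset G -> #|G : H| = 2 -> gpcgs d gs -> H =i gwords gs ->
  exists d1 g, [/\ d1 \in pc_extensions d, gpcgs d1 (rcons gs g)
                  & G =i gwords (rcons gs g)].
Proof.
move=> sHG iGH gsP gsH; have [g0 g0P] : exists g, g \in G :\: H.
  apply/set0Pn; rewrite setD_eq0; apply: contraPN iGH => sGH.
  by rewrite (_ : H :=: G) ?indexgg //; apply/eqP; rewrite eqEsubset sHG.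
pose g := [arg min_(x < g0 in G :\: H) index (x * x) (gwords gs)].
have [gGH g_min] : g \in G :\: H /\
    forall x, x \in G :\: H -> index (g * g) (gwords gs) <= index (x * x) (gwords gs).
  by rewrite /g; case: arg_minnP.
have [gP gG] := extension_pcgs sHG iGH gsP gsH gGH.
have /andP[/pc_relations_tabulates tbP s_uniq] := gsP.
exists (rcons d (conj_numbers gs g, square_number gs g)), g; split=> //.
apply/allpairsPdep; exists (conj_numbers gs g), (square_number gs g); split=> //.
  rewrite (mem_pc_solutions tbP s_uniq) (conj_numbers_lt sHG iGH gsH gGH).
  by rewrite (conj_numbersE sHG iGH gsH gGH) pcgs_conj gsP.
rewrite mem_filter (extension_is_ok sHG iGH gsP gsH gGH g_min) mem_iota /=.
by rewrite (tabulates_size tbP) (index_words_lt gsH) // (index2_square sHG iGH gGH).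
Qed.

Lemma extensions_contain_pcgs H G R R' d gs :
    extensions_contain R R' -> H \subset G -> #|G : H| = 2 ->
    d \in R -> gpcgs d gs -> H =i gwords gs ->
  exists d' gs', [/\ d' \in R', gpcgs d' gs' & {subset gwords gs' <= G}].
Proof.
move=> /allP ext sHG iGH dR gsP gsH.
have [d1 [g [d1P gs1P gs1G]]] := index2_pcgs_extension sHG iGH gsP gsH.
have /andP[/pc_relations_tabulates tb1P uniq1] := gs1P.
have := allP (ext d dR) d1 d1P; rewrite /= searchE => /hasP[d' d'R'].
case sol: (pc_solutions _ _ _) => [//|hs sols] _.
have /andP[hs_lt hsP] : all (gtn (size (gwords (rcons gs g)))) hs &&
    gpcgs d' (map (nth 1 (gwords (rcons gs g))) hs).
  by rewrite -(mem_pc_solutions tb1P uniq1) sol mem_head.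
exists d', (map (nth 1 (gwords (rcons gs g))) hs); split=> // x.
rewrite -(map_twords tb1P hs_lt) => /mapP[k k_ws ->]; rewrite gs1G mem_nth //.
exact: (allP (twords_lt tb1P hs_lt)).
Qed.

End Classification.

Section Presentations.

Local Open Scope nat_scope.

Definition pc_C2xQ8 : pc_presentation :=
  [:: ([::], 0); ([:: 1], 0); ([:: 1; 2], 1); ([:: 1; 2; 5], 1)].

Definition pc_C4oD8 : pc_presentation :=
  [:: ([::], 0); ([:: 1], 0); ([:: 1; 2], 1); ([:: 1; 3; 4], 0)].

Definition pc_C8xC2 : pc_presentation :=
  [:: ([::], 0); ([:: 1], 0); ([:: 1; 2], 1); ([:: 1; 2; 4], 4)].

Definition pc_C4xC4 : pc_presentation :=
  [:: ([::], 0); ([:: 1], 0); ([:: 1; 2], 1); ([:: 1; 2; 4], 2)].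

(* C8 x C2, M16, C4 x C4, C4 x C2 x C2, D8 x C2, C2^2 : C4, C2^4, C4 : C4, D16, SD16, C16
   and Q16. *)
Definition mated_groups16 : seq pc_presentation :=
  [:: pc_C8xC2;
      [:: ([::], 0); ([:: 1], 0); ([:: 1; 2], 1); ([:: 1; 3; 4], 4)];
      pc_C4xC4;
      [:: ([::], 0); ([:: 1], 0); ([:: 1; 2], 0); ([:: 1; 2; 4], 1)];
      [:: ([::], 0); ([:: 1], 0); ([:: 1; 2], 0); ([:: 1; 2; 5], 0)];
      [:: ([::], 0); ([:: 1], 0); ([:: 1; 2], 0); ([:: 1; 2; 5], 2)];
      [:: ([::], 0); ([:: 1], 0); ([:: 1; 2], 0); ([:: 1; 2; 4], 0)];
      [:: ([::], 0); ([:: 1], 0); ([:: 1; 2], 1); ([:: 1; 2; 5], 2)];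
      [:: ([::], 0); ([:: 1], 0); ([:: 1; 3], 0); ([:: 1; 4; 2], 0)];
      [:: ([::], 0); ([:: 1], 0); ([:: 1; 3], 0); ([:: 1; 4; 2], 1)];
      [:: ([::], 0); ([:: 1], 1); ([:: 1; 2], 2); ([:: 1; 2; 4], 4)];
      [:: ([::], 0); ([:: 1], 1); ([:: 1; 2], 2); ([:: 1; 3; 7], 1)]].

Definition unmated_groups16 : seq pc_presentation := [:: pc_C2xQ8; pc_C4oD8].

Definition small_2groups k : seq pc_presentation :=
  nth [::]
    [:: [:: [::]];
        [:: [:: ([::], 0)]];
        [:: [:: ([::], 0); ([:: 1], 0)]; [:: ([::], 0); ([:: 1], 1)]];
        [:: [:: ([::], 0); ([:: 1], 0); ([:: 1; 2], 0)];
            [:: ([::], 0); ([:: 1], 0); ([:: 1; 2], 1)];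
            [:: ([::], 0); ([:: 1], 0); ([:: 1; 3], 0)];
            [:: ([::], 0); ([:: 1], 1); ([:: 1; 2], 2)];
            [:: ([::], 0); ([:: 1], 1); ([:: 1; 3], 1)]];
        mated_groups16 ++ unmated_groups16] k.

Definition pc_extraspecial32 : pc_presentation :=
  [:: ([::], 0); ([:: 1], 0); ([:: 1; 2], 1); ([:: 1; 3; 4], 0); ([:: 1; 2; 5; 8], 1)].

Definition mated_groups := rcons mated_groups16 pc_extraspecial32.

End Presentations.

Lemma size_small_2group k d : k <= 4 -> d \in small_2groups k -> size d = k.
Proof.
have : all (fun k => all (fun d => size d == k) (small_2groups k)) (iota 0 5) by [].
move=> /allP sizeP lek /(allP (sizeP k _)) /eqP-> //.
by rewrite mem_iota.
Qed.

Lemma small_2groups_extensions :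
  all (fun k => extensions_contain (small_2groups k) (small_2groups k.+1)) (iota 0 4).
Proof. by vm_cast_no_check (erefl true). Qed.

Lemma unmated_groups16_extensions : extensions_contain unmated_groups16 mated_groups.
Proof. by vm_cast_no_check (erefl true). Qed.

Lemma sub_pgroup (gT : finGroupType) (G : {group gT}) p n k :
    prime p -> #|G| = (p ^ n)%N -> k <= n ->
  exists2 H : {group gT}, H \subset G & #|H| = (p ^ k)%N.
Proof.
move=> p_pr cG lekn; have pG : p.-group G by rewrite /pgroup cG pnatX pnat_id.
have [H [sHG _ cH]] : exists H : {group gT},
    [/\ H \subset G, H <| G & #|H| = (p ^ k)%N].
  by apply: (normal_pgroup pG (normal_refl G)); rewrite cG pfactorK.
by exists H.
Qed.

Lemma small_2group_pcgs (gT : finGroupType) (G : {group gT}) k :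
  k <= 4 -> #|G| = (2 ^ k)%N ->
  exists d gs, [/\ d \in small_2groups k, gpcgs d gs & G =i gwords gs].
Proof.
elim: k G => [|k IHk] G lek cG.
  exists [::], [::]; split=> // x.
  by have /card1_trivg-> : #|G| = 1%N := cG; rewrite !inE.
have [H sHG cH] := sub_pgroup (isT : prime 2) cG (leqnSn k).
have iGH : #|G : H| = 2 by rewrite -divgS // cG cH expnS mulnK // expn_gt0.
have [d [gs [dk gsP gsH]]] := IHk H (ltnW lek) cH.
have ext : extensions_contain (small_2groups k) (small_2groups k.+1).
  by apply: (allP small_2groups_extensions); rewrite mem_iota.
have [d' [gs' [d'k gs'P sG]]] := extensions_contain_pcgs ext sHG iGH dk gsP gsH.
exists d', gs'; split=> // x; apply/idP/idP=> [|/sG//].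
have /andP[gs'R gs'_uniq] := gs'P.
have [||_ ->] := uniq_min_size gs'_uniq (s2 := enum G); rewrite ?mem_enum //.
  by move=> y /sG; rewrite mem_enum.
by rewrite -cardE cG size_words (size_pcgs gs'R) (size_small_2group lek d'k).
Qed.

(** * Cayley graphs *)

Section CayleyGraph.

Variables (gT : finGroupType) (S : {set gT}).

Lemma cayley_regular : regular (cayley S) #|S|.
Proof.
move=> x; have inj : injective (fun y : gT => x * y^-1) by move=> y z /mulgI/invg_inj.
rewrite -(card_imset _ inj); apply: eq_card => y.
apply/imsetP/idP => [[z zS ->] //|yS]; rewrite ?unfold_in /cayley ?invMg ?invgK ?mulKVg //.
by exists (y^-1 * x); rewrite ?unfold_in /cayley invMg invgK mulKVg.
Qed.

Lemma cayley_translation g : component_embedding (cayley S) (cayley S) (mulg^~ g).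
Proof.
split=> [|x y|x y' _]; [exact: mulIg | by rewrite /cayley invMg mulgA mulgK |].
by exists (y' * g^-1); rewrite mulgKV.
Qed.

Lemma K4_count_cayley u : K4_count (cayley S) u = K4_count (cayley S) 1.
Proof. by rewrite -{1}[u]mul1g (K4_count_embedding (cayley_translation u)). Qed.

Lemma nwalks_component (T : finType) (e : rel T) f j x :
  component_embedding e (cayley S) f -> nwalks e j x x = nwalks (cayley S) j 1 1.
Proof.
move=> fP; rewrite -(nwalks_embedding fP) -{1 2}[f x]mul1g.
exact: nwalks_embedding (cayley_translation (f x)) _ _ _.
Qed.

Lemma closed_walks_component (T : finType) (e : rel T) f j :
  component_embedding e (cayley S) f ->
  closed_walks e j = (#|T| * nwalks (cayley S) j 1%g 1%g)%N.
Proof.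
by move=> fP; rewrite -sum_nat_const; apply: eq_bigr => x _; apply: nwalks_component fP.
Qed.

Lemma closed_walks_cayley j :
  closed_walks (cayley S) j = (#|gT| * nwalks (cayley S) j 1%g 1%g)%N.
Proof. exact: closed_walks_component (cayley_translation 1). Qed.

End CayleyGraph.

Lemma cospectral_cayley_nwalks (gT hT : finGroupType) (S : {set gT}) (S' : {set hT}) j :
    connection_set S -> connection_set S' -> cospectral (cayley S) (cayley S') ->
  nwalks (cayley S) j 1 1 = nwalks (cayley S') j 1 1.
Proof.
move=> /cayley_simple[es _] /cayley_simple[es' _] cos.
have /eqP := (cospectralP es es').1 cos j.
rewrite !closed_walks_cayley -(cospectral_card cos) eqn_mul2l => /orP[|/eqP//].
by rewrite -cardsT eqn0Ngt cardG_gt0.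
Qed.

Lemma cospectral_cayley_components (gT hT : finGroupType) (S : {set gT}) (S' : {set hT})
    (T T' : finType) (e : rel T) (e' : rel T') f f' :
    connection_set S -> connection_set S' -> #|gT| = #|hT| ->
    component_embedding e (cayley S) f -> component_embedding e' (cayley S') f' ->
    0 < #|T| -> cospectral e e' ->
  cospectral (cayley S) (cayley S').
Proof.
move=> cS cS' cT fP f'P T_gt0 cos; have [es _] := cayley_simple cS.
have [es' _] := cayley_simple cS'.
apply/(cospectralP es es') => j; rewrite !closed_walks_cayley cT; congr (_ * _)%N.
have [e_sym _] := component_embedding_simple fP (cayley_simple cS).
have [e'_sym _] := component_embedding_simple f'P (cayley_simple cS').
have /eqP := (cospectralP e_sym e'_sym).1 cos j.
rewrite (closed_walks_component _ fP) (closed_walks_component _ f'P) -(cospectral_card cos).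
by rewrite eqn_pmul2l // => /eqP.
Qed.

(* Closed walks and complete subgraphs at a vertex stay in its component and are the same
   at all vertices, so unions of components represent the Cayley graphs. *)
Lemma not_Cay_DS_components (gT hT : finGroupType) (S : {set gT}) (S' : {set hT})
    (T T' : finType) (e : rel T) (e' : rel T') f f' x x' :
    connection_set S -> connection_set S' -> #|gT| = #|hT| ->
    component_embedding e (cayley S) f -> component_embedding e' (cayley S') f' ->
    cospectral e e' -> K4_count e x != K4_count e' x' ->
  ~ Cay_DS gT.
Proof.
move=> cS cS' cT fP f'P cos K4_neq cayDS; case/eqP: K4_neq.
have cosS : cospectral (cayley S) (cayley S').
  by apply: (cospectral_cayley_components cS cS' cT fP f'P) => //; apply/card_gt0P; exists x.
have [g _ gP] := graph_iso_embedding (cayDS S cS hT S' cS' cosS).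
rewrite -(K4_count_embedding fP) -(K4_count_embedding f'P) -(K4_count_embedding gP).
by rewrite [LHS]K4_count_cayley [RHS]K4_count_cayley.
Qed.

Definition inverse_table (tb : seq (seq nat)) := [seq index 0 r | r <- tb].

Definition division_table tb := [seq [seq nth 0 r k | k <- inverse_table tb] | r <- tb].

Section CayleyRows.

Variables (gT : finGroupType) (d : pc_presentation) (gs : seq gT).
Hypothesis gsP : gpcgs d gs.

Local Notation s := (gwords gs).
Local Notation tb := (pc_table d).
Local Notation m := (2 ^ size d)%N.

Let tbP : tabulates tb s.
Proof. by case/andP: gsP => /pc_relations_tabulates. Qed.

Let s_uniq : uniq s.
Proof. by case/andP: gsP. Qed.

Lemma size_words_pcgs : size s = m.
Proof. by case/andP: gsP => /size_pcgs <-; rewrite size_words. Qed.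

Lemma nth_inverse_table i : i < m ->
  nth 0 (inverse_table tb) i < m /\ nth 1 s (nth 0 (inverse_table tb) i) = (nth 1 s i)^-1.
Proof.
rewrite -size_words_pcgs => lti; have [_ rowE] := tabulates_row tbP lti.
have size_row : size (nth [::] tb i) = size s.
  by rewrite -[RHS](size_map (mulg (nth 1 s i))) -rowE size_map.
rewrite (nth_map [::]) ?(tabulates_size tbP) //.
have row0 : 0 \in nth [::] tb i.
  pose H := Group (tabulates_group_set tbP).
  have /(nthP 1)[k ltk kE] : (nth 1 s i)^-1 \in s.
    have : (nth 1 s i)^-1 \in H by rewrite groupV inE mem_nth.
    by rewrite inE.
  have [lt_ik ikE] := tabulates_mul tbP lti ltk.
  have <- : tmul tb i k = 0.
    by apply: (nth_words_inj s_uniq); rewrite ?inE ?words_gt0 // ikE kE mulgV nth_words_one.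
  by rewrite mem_nth ?size_row.
have lt_index : index 0 (nth [::] tb i) < size s by rewrite -size_row index_mem.
split=> //; apply/esym/eqP; rewrite eq_invg_mul.
have [_ <-] := tabulates_mul tbP lti lt_index.
by rewrite /tmul nth_index // nth_words_one.
Qed.

Lemma cayley_rows_embedding (S : {set gT})
    (M := rows_of (division_table tb) [seq x \in S | x <- s]) :
  {subset S <= s} ->
  component_embedding (@row_rel M) (cayley S) (fun i : 'I_(size M) => nth 1 s i).
Proof.
move=> sS; have size_s := size_words_pcgs.
have sizeD : size (division_table tb) = m by rewrite size_map size_pc_table.
have sizeM : size M = m by rewrite size_map.
have lt_m (i : 'I_(size M)) : i < m by rewrite -sizeM.
split=> [i j /eqP|i j|i y iy].
- by rewrite nth_uniq ?size_s // => /eqP/val_inj.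
- have [lt_inv invE] := nth_inverse_table (lt_m j).
  have [lti lti'] : i < size s /\ nth 0 (inverse_table tb) j < size s by rewrite size_s.
  have [lt_ij ijE] := tabulates_mul tbP lti lti'.
  have rowE : nth [::] (division_table tb) i = [seq tmul tb i k | k <- inverse_table tb].
    by rewrite (nth_map [::]) ?size_pc_table.
  have size_inv : size (inverse_table tb) = m by rewrite size_map size_pc_table.
  rewrite /row_rel nth_rows_of ?rowE ?sizeD ?size_map ?size_inv //.
  by rewrite (nth_map 0) ?size_inv // (nth_map 1) // ijE invE.
pose H := Group (tabulates_group_set tbP).
have memH x : (x \in s) = (x \in H) by rewrite inE.
have /(nthP 1)[k ltk kE] : y \in s.
  have := sS _ iy; rewrite !memH groupMl ?groupV // -memH mem_nth // size_s.
  exact: lt_m.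
by rewrite size_s -sizeM in ltk; exists (Ordinal ltk).
Qed.

End CayleyRows.

(** * Cospectral Cayley graphs that are not isomorphic *)

Definition is_connection_list d (S : seq nat) :=
  [&& all (gtn (2 ^ size d)%N) S, 0 \notin S
    & all (fun i => nth 0 (inverse_table (pc_table d)) i \in S) S].

Definition pc_cayley_rows d (S : seq nat) :=
  rows_of (division_table (pc_table d)) [seq i \in S | i <- iota 0 (2 ^ size d)].

Lemma size_pc_cayley_rows d S : size (pc_cayley_rows d S) = (2 ^ size d)%N.
Proof. by rewrite !size_map size_pc_table. Qed.

Section ConnectionLists.

Variables (gT : finGroupType) (d : pc_presentation) (gs : seq gT) (S : seq nat).
Hypotheses (gsP : gpcgs d gs) (S_conn : is_connection_list d S).

Local Notation s := (gwords gs).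

Definition listed_set : {set gT} := [set x in [seq nth 1 s i | i <- S]].

Let size_s := size_words_pcgs gsP.

Let S_lt i : i \in S -> i < 2 ^ size d.
Proof. by have /and3P[/allP S_lt _ _] := S_conn => /S_lt. Qed.

Lemma mem_listed_set i : i < 2 ^ size d -> (nth 1 s i \in listed_set) = (i \in S).
Proof.
have /andP[_ s_uniq] := gsP => lti; rewrite inE; apply/mapP/idP => [[j jS /eqP]|iS].
  by have ltj := S_lt jS; rewrite nth_uniq ?size_s // => /eqP->.
by exists i.
Qed.

Lemma pc_cayley_rows_embedding :
  component_embedding (@row_rel (pc_cayley_rows d S)) (cayley listed_set)
    (fun i : 'I_(size (pc_cayley_rows d S)) => nth 1 s i).
Proof.
have S_sub : {subset listed_set <= s}.
  by move=> x; rewrite inE => /mapP[i /S_lt lti ->]; rewrite mem_nth ?size_s.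
have := cayley_rows_embedding gsP S_sub.
have -> // : [seq x \in listed_set | x <- s] = [seq i \in S | i <- iota 0 (2 ^ size d)].
rewrite -[X in map _ X](mkseq_nth 1 s) -map_comp size_s; apply/eq_in_map=> i.
by rewrite mem_iota /= => lti; rewrite mem_listed_set.
Qed.

Lemma connection_listed_set : connection_set listed_set.
Proof.
have /and3P[_ S0 /allP SV] := S_conn; split.
  by rewrite -(nth_words_one mulg 1 gs) mem_listed_set ?expn_gt0.
apply/eqP; rewrite eqEcard card_invg leqnn andbT; apply/subsetP=> x.
rewrite inE inE => /mapP[i iS xE]; have lti := S_lt iS.
have [ltv vE] := nth_inverse_table gsP lti.
by rewrite -[x]invgK xE -vE mem_listed_set // SV.
Qed.

End ConnectionLists.

(* Spectra of graphs on m vertices agree once the first 2m closed walk counts do. *)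
Definition cospectral_mates (c c' : pc_presentation * seq nat) :=
  let M := pc_cayley_rows c.1 c.2 in let M' := pc_cayley_rows c'.1 c'.2 in
  let l := (2 ^ size c.1)%N.*2 in
  [&& size c.1 == size c'.1, is_connection_list c.1 c.2, is_connection_list c'.1 c'.2,
      closed_walks_at l M 0 == closed_walks_at l M' 0
    & K4_count_rows M 0 != K4_count_rows M' 0].

Lemma cospectral_mates_not_Cay_DS (gT hT : finGroupType) (gs : seq gT) (gs' : seq hT)
    d S d' S' :
    gpcgs d gs -> gpcgs d' gs' -> #|gT| = #|hT| -> cospectral_mates (d, S) (d', S') ->
  ~ Cay_DS gT.
Proof.
move=> gsP gs'P cT /and5P[/eqP /= dd' S_conn S'_conn /eqP walksE K4_neq].
have fP := pc_cayley_rows_embedding gsP S_conn.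
have f'P := pc_cayley_rows_embedding gs'P S'_conn.
have cS := connection_listed_set gsP S_conn.
have cS' := connection_listed_set gs'P S'_conn.
have [sizeM sizeM'] := (size_pc_cayley_rows d S, size_pc_cayley_rows d' S').
have M_gt0 : 0 < size (pc_cayley_rows d S) by rewrite sizeM expn_gt0.
have M'_gt0 : 0 < size (pc_cayley_rows d' S') by rewrite sizeM' expn_gt0.
pose i0 := Ordinal M_gt0; pose i0' := Ordinal M'_gt0.
have es := (component_embedding_simple fP (cayley_simple cS)).1.
have es' := (component_embedding_simple f'P (cayley_simple cS')).1.
apply: (not_Cay_DS_components (x := i0) (x' := i0') cS cS' cT fP f'P); last first.
  by rewrite -!K4_count_rowsE.
apply: (cospectral_of_walks es es') => j; rewrite !card_ord => ltj.
rewrite sizeM sizeM' -dd' addnn in ltj.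
rewrite (closed_walks_component _ fP) (closed_walks_component _ f'P) !card_ord sizeM sizeM'.
rewrite -dd'; congr (_ * _)%N; case: j ltj => [|j] ltj; first by rewrite /= !eqxx.
rewrite -(nwalks_component _ i0 fP) -(nwalks_component _ i0' f'P).
have := congr1 (map BinNat.N.to_nat) walksE.
rewrite (closed_walks_atE _ i0) (closed_walks_atE _ i0') => /eq_in_map/(_ j.+1); apply.
by rewrite mem_iota /= add1n ltnS ltnW.
Qed.

Section Mates.

Local Open Scope nat_scope.

Definition shrikhande := (pc_C4xC4, [:: 4; 5; 8; 10; 12; 15]).

Definition degree7_mate := (pc_C8xC2, [:: 1; 4; 5; 8; 10; 13; 15]).

(* The lexicographic product of the Shrikhande graph with two isolated vertices. *)
Definition doubled_shrikhande :=
  (rcons pc_C4xC4 ([:: 1; 2; 4; 8], 0),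
   [:: 4; 5; 8; 10; 12; 15; 20; 21; 24; 26; 28; 31]).

(* A connection set for each member of mated_groups, and a mate of its Cayley graph.  The
   mates of the Shrikhande graph are 4 x 4 rook graphs. *)
Definition witnesses : seq (seq nat * (pc_presentation * seq nat)) :=
  [:: ([:: 1; 2; 3; 8; 10; 13; 15], degree7_mate);
      ([:: 2; 3; 8; 10; 13; 14], shrikhande);
      ([:: 1; 4; 5; 2; 8; 10], shrikhande);
      ([:: 1; 8; 9; 2; 4; 6], shrikhande);
      ([:: 1; 12; 13; 2; 4; 6], shrikhande);
      ([:: 2; 8; 10; 3; 4; 7], shrikhande);
      ([:: 1; 2; 3; 4; 8; 12], shrikhande);
      ([:: 1; 4; 5; 2; 8; 10], shrikhande);
      ([:: 1; 2; 3; 6; 7; 8; 9], degree7_mate);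
      ([:: 2; 4; 8; 9; 10; 13], shrikhande);
      ([:: 1; 2; 3; 8; 9; 14; 15], degree7_mate);
      ([:: 1; 2; 3; 8; 9; 12; 13], degree7_mate);
      ([:: 2; 3; 4; 5; 6; 7; 8; 9; 16; 17; 24; 25], doubled_shrikhande)].

Lemma mated_groups_witnesses :
  all (fun c => cospectral_mates (c.1, c.2.1) c.2.2) (zip mated_groups witnesses).
Proof. by vm_cast_no_check (erefl true). Qed.

Definition realized d := exists (K : finGroupType) (gs : seq K),
  gpcgs d gs /\ #|K| = 2 ^ size d.

Lemma witnesses_realized w : w \in witnesses -> realized w.2.1.
Proof.
have C4 : realized pc_C4xC4.
  exists ('I_4 * 'I_4)%type,
    [:: (inZp 2, inZp 0); (inZp 0, inZp 2); (inZp 1, inZp 0); (inZp 0, inZp 1)].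
  by split; [vm_compute | rewrite card_prod !card_ord].
have C8 : realized pc_C8xC2.
  exists ('I_8 * 'I_2)%type,
    [:: (inZp 4, inZp 0); (inZp 0, inZp 1); (inZp 2, inZp 0); (inZp 1, inZp 0)].
  by split; [vm_compute | rewrite card_prod !card_ord].
have C4C2 : realized doubled_shrikhande.1.
  exists ('I_4 * 'I_4 * 'I_2)%type,
    [:: (inZp 2, inZp 0, inZp 0); (inZp 0, inZp 2, inZp 0); (inZp 1, inZp 0, inZp 0);
        (inZp 0, inZp 1, inZp 0); (inZp 0, inZp 0, inZp 1)].
  by split; [vm_compute | rewrite !card_prod !card_ord].
have sub : {subset [seq w.2.1 | w <- witnesses] <=
    [:: pc_C4xC4; pc_C8xC2; doubled_shrikhande.1]} by apply/allP.
by move=> /(map_f (fun w => w.2.1))/sub; rewrite !inE => /or3P[] /eqP->.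
Qed.

End Mates.

Lemma mated_not_Cay_DS (gT : finGroupType) d (gs : seq gT) :
  d \in mated_groups -> gpcgs d gs -> 2 ^ size d %| #|gT| -> ~ Cay_DS gT.
Proof.
move=> dM gsP /dvdnP[q cT].
have [w wW mates] : exists2 w, w \in witnesses & cospectral_mates (d, w.1) w.2.
  have : d \in unzip1 (zip mated_groups witnesses) by rewrite unzip1_zip.
  case/mapP=> -[d' w] dw /= dE; exists w; last first.
    by rewrite dE; apply: (allP mated_groups_witnesses _ dw).
  by rewrite -(@unzip2_zip _ _ mated_groups witnesses) //; apply: (map_f snd dw).
have [K [gs' [gs'P cK]]] := witnesses_realized wW.
have q_gt0 : 0 < q by have := cardG_gt0 [set: gT]; rewrite cardsT cT; case: q {cT}.
have gs''P : gpcgs w.2.1 [seq (x, 1 : 'I_q.-1.+1) | x <- gs'].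
  rewrite (@map_pcgs _ _ mulg 1 _ _ predT) ?all_predT //; last by move=> x y _ _ [].
  by move=> x y _ _; congr (_, _); rewrite mulg1.
have /eqP size_dw : size d == size w.2.1 by case/and5P: mates.
apply: (cospectral_mates_not_Cay_DS gsP gs''P _ (S' := w.2.2)); last first.
  by case: (w.2) mates => d' S'; apply.
by rewrite card_prod card_ord prednK // cK -size_dw cT mulnC.
Qed.

(** * Cayley graphs on the remaining two groups *)

(* Only C2^4, among the groups of order 16, has more than 192 automorphisms: using all of
   its 20160 automorphisms would slow the enumeration down. *)
Definition cayley_candidates d :=
  let tb := pc_table d in
  candidates (inverse_table tb) [:: ([:: 0], true, 0); (iota 0 (size tb), true, 7)]
    [seq twords tb hs | hs <- take 192 (pc_solutions tb [::] d)].

Definition low_degree_cayley_rows d :=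
  [seq rows_of (division_table (pc_table d)) p | p <- cayley_candidates d].

Section LowDegree.

Variables (gT : finGroupType) (S : {set gT}) (d : pc_presentation).
Hypotheses (S_conn : connection_set S) (cT : #|gT| = (2 ^ size d)%N).

Definition membership_code (gs : seq gT) := [seq x \in S | x <- gwords gs].

Lemma pcgs_enumerates (gs : seq gT) : gpcgs d gs -> enumerates (gwords gs).
Proof.
move=> gsP; have /andP[_ s_uniq] := gsP; apply: uniq_perm; rewrite ?enum_uniq //.
have [||_ //] := uniq_min_size s_uniq (s2 := enum gT).
  by move=> x _; rewrite mem_enum.
by rewrite -cardE cT (size_words_pcgs gsP).
Qed.

Lemma mem_full_words (gs : seq gT) x : gpcgs d gs -> x \in gwords gs.
Proof. by move=> /pcgs_enumerates/perm_mem->; rewrite mem_enum. Qed.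

Lemma nth_membership_code gs i : gpcgs d gs -> i < 2 ^ size d ->
  nth false (membership_code gs) i = (nth 1 (gwords gs) i \in S).
Proof. by move=> gsP lti; rewrite (nth_map 1) ?(size_words_pcgs gsP). Qed.

Lemma membership_code_action gs hs : gpcgs d gs -> hs \in pc_solutions (pc_table d) [::] d ->
  exists2 gs', gpcgs d gs' & membership_code gs' =
    [seq nth false (membership_code gs) j | j <- twords (pc_table d) hs].
Proof.
move=> gsP; have /andP[/pc_relations_tabulates tbP s_uniq] := gsP.
rewrite (mem_pc_solutions tbP s_uniq) => /andP[hs_lt hsP].
exists (map (nth 1 (gwords gs)) hs) => //.
rewrite /membership_code -(map_twords tbP hs_lt) -map_comp.
apply/eq_in_map=> j /(allP (twords_lt tbP hs_lt)) ltj.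
by rewrite /= nth_membership_code -?(size_words_pcgs gsP).
Qed.

Lemma cayley_iso_rows (gs : seq gT) : gpcgs d gs -> #|S| <= 7 ->
  exists2 M, M \in low_degree_cayley_rows d & graph_iso (@row_rel M) (cayley S).
Proof.
move=> gsP leS; have [S1 SV] := S_conn; have size_tb := size_pc_table d.
have size_inv : size (inverse_table (pc_table d)) = (2 ^ size d)%N by rewrite size_map.
have [qs qsP codeC] : exists2 qs, gpcgs d qs & membership_code qs \in cayley_candidates d.
  apply: (@exists_candidate _ (fun qs : seq gT => gpcgs d qs) _ _ _ _ _ _ gs) => //.
  - by move=> qs qsP; rewrite size_map size_inv (size_words_pcgs qsP).
  - by move=> qs _ qsP /mapP[hs /mem_take hs_sol ->]; apply: membership_code_action.
  - move=> qs i qsP; rewrite size_inv => lti.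
    have [lt_inv invE] := nth_inverse_table qsP lti.
    by rewrite !nth_membership_code // invE -{1}SV mem_invg invgK.
  move=> qs qsP; rewrite /= /meets_quota /= nth_membership_code ?expn_gt0 //.
  rewrite nth_words_one (negPf S1) /= andbT size_tb.
  apply: leq_trans leS; rewrite (card_count _ (pcgs_enumerates qsP)).
  rewrite -[X in _ <= count _ X](mkseq_nth 1) (size_words_pcgs qsP) count_map.
  apply/eq_leq/eq_in_count=> i; rewrite mem_iota /= => lti.
  by rewrite nth_membership_code // eqb_id.
have M_sub : {subset S <= gwords qs} by move=> x _; apply: mem_full_words.
exists (rows_of (division_table (pc_table d)) (membership_code qs)); first exact: map_f.
apply: component_embedding_iso (cayley_rows_embedding qsP M_sub) _.
by rewrite card_ord !size_map size_tb cT.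
Qed.

End LowDegree.

Definition walk_key M := closed_walks_at 8 M 0.

Definition low_degree_rows ds := flatten [seq low_degree_cayley_rows d | d <- ds].

Lemma low_degree_rows_separated :
  separated walk_key (low_degree_rows (small_2groups 4)) (low_degree_rows unmated_groups16).
Proof. by vm_cast_no_check (erefl true). Qed.

Lemma size_low_degree_rows k : k <= 4 ->
  {in low_degree_rows (small_2groups k), forall M, size M = (2 ^ k)%N}.
Proof.
move=> lek M /flattenP[_ /mapP[d dk ->] /mapP[p _ ->]].
by rewrite !size_map size_pc_table (size_small_2group lek dk).
Qed.

Lemma walk_key_iso (gT : finGroupType) (S : {set gT}) M :
  graph_iso (@row_rel M) (cayley S) ->
  [seq BinNat.N.to_nat c | c <- walk_key M] = [seq nwalks (cayley S) j 1 1 | j <- iota 1 8].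
Proof.
case/graph_iso_embedding=> f [f' fK f'K] fP; pose i := f' 1.
have M_gt0 : 0 < size M by apply: leq_ltn_trans (ltn_ord i).
rewrite /walk_key (closed_walks_atE _ (Ordinal M_gt0)); apply: eq_map => j.
exact: nwalks_component fP.
Qed.

Lemma unmated_low_degree_iso (gT hT : finGroupType) (S : {set gT}) (S' : {set hT}) d
    (gs : seq gT) :
    #|gT| = 16 -> d \in unmated_groups16 -> gpcgs d gs ->
    connection_set S -> connection_set S' -> #|S| <= 7 -> #|S'| <= 7 ->
  cospectral (cayley S) (cayley S') -> graph_iso (cayley S) (cayley S').
Proof.
move=> cT dU gsP cS cS' leS leS' cos; have cH := cospectral_card cos; rewrite cT in cH.
have [d' [gs' [d'G gs'P _]]] : exists d' gs',
    [/\ d' \in small_2groups 4, gpcgs d' gs' & [set: hT] =i gwords gs'].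
  by apply: small_2group_pcgs; rewrite // cardsT -cH.
have dG : d \in small_2groups 4 by rewrite mem_cat dU orbT.
have cTd : #|gT| = (2 ^ size d)%N by rewrite (size_small_2group _ dG).
have cHd' : #|hT| = (2 ^ size d')%N by rewrite (size_small_2group _ d'G).
have [M Md isoM] := cayley_iso_rows cS cTd gsP leS.
have [M' M'd' isoM'] := cayley_iso_rows cS' cHd' gs'P leS'.
have memL ds D N : D \in ds -> N \in low_degree_cayley_rows D -> N \in low_degree_rows ds.
  by move=> Dds NR; apply/flattenP; exists (low_degree_cayley_rows D); rewrite ?map_f.
have subL : {subset low_degree_rows unmated_groups16 <= low_degree_rows (small_2groups 4)}.
  move=> N /flattenP[_ /mapP[D DU ->]]; apply: memL.
  by rewrite mem_cat DU orbT.
apply: graph_iso_trans (graph_iso_sym isoM) (graph_iso_trans (graph_iso_sym _) isoM').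
apply: (separated_iso low_degree_rows_separated subL (@size_low_degree_rows 4 isT)).
- exact: memL d'G M'd'.
- exact: memL dU Md.
- exact: graph_iso_simple isoM' (cayley_simple cS').
apply: (inj_map Nnat.N2Nat.inj); rewrite (walk_key_iso isoM) (walk_key_iso isoM').
by apply: eq_map => j; rewrite (cospectral_cayley_nwalks _ cS cS' cos).
Qed.

Lemma graph_compl_cayley (gT : finGroupType) (S : {set gT}) :
  graph_iso (graph_compl (cayley S)) (cayley (~: (1 |: S))).
Proof.
exists id; first by exists id.
by move=> x y; rewrite /graph_compl /cayley !inE negb_or -eq_mulgV1.
Qed.

Lemma connection_set_compl (gT : finGroupType) (S : {set gT}) :
  connection_set S -> connection_set (~: (1 |: S)).
Proof.
case=> S1 SV; split; first by rewrite !inE eqxx.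
by apply/setP=> x; rewrite mem_invg !in_setC !in_setU1 invg_eq1 -mem_invg SV.
Qed.

Lemma unmated_Cay_DS (gT : finGroupType) d (gs : seq gT) : #|gT| = 16 ->
  d \in unmated_groups16 -> gpcgs d gs -> Cay_DS gT.
Proof.
move=> cT dU gsP S cS hT S' cS' cos; have [eS eS'] := (cayley_simple cS, cayley_simple cS').
have T_gt0 : 0 < #|gT| by rewrite cT.
have regS' := cospectral_regular eS.1 eS'.1 (cayley_regular S) cos.
have SS' : #|S'| = #|S| by rewrite -(regS' 1) (cayley_regular S').
apply: (graph_iso_cospectral_regular T_gt0 eS eS' (cayley_regular S) cos) => [ltS|ltS cosC].
  rewrite cT -(gtn_uphalf_double 16) ltnS in ltS.
  by apply: (unmated_low_degree_iso cT dU gsP); rewrite ?SS'.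
have [cC cC'] := (connection_set_compl cS, connection_set_compl cS').
have [isoS isoS'] := (graph_compl_cayley S, graph_compl_cayley S').
apply: (graph_iso_trans isoS (graph_iso_trans _ (graph_iso_sym isoS'))).
have le7 (rT : finGroupType) (X : {set rT}) :
    connection_set X -> #|rT| = 16 -> #|X| = #|S| -> #|~: (1 |: X)| <= 7.
  case=> X1 _ cR cX; have := cardsC (1 |: X); rewrite cardsU1 X1 cR cX => cC1.
  by rewrite cT -(gtn_uphalf_double 16) ltnS -cC1 -addnA addnCA addKn in ltS.
apply: (unmated_low_degree_iso cT dU gsP cC cC').
- exact: le7.
- by apply: le7; rewrite // -(cospectral_card cos).
rewrite /cospectral (perm_trans _ (perm_trans cosC _)) //.
  by rewrite perm_sym (graph_iso_cospectral (graph_compl_simple eS) (cayley_simple cC) isoS).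
exact: graph_iso_cospectral (graph_compl_simple eS') (cayley_simple cC') isoS'.
Qed.

(** * The two exceptional groups of order 16 *)

Lemma gen_words (gT : finGroupType) d (gs : seq gT) : pc_relations mulg 1 [::] d gs ->
  <<[set x in gs]>> = [set x in gwords gs].
Proof.
move=> gsR; have wordsP := tabulates_group_set (pc_relations_tabulates gsR).
apply/eqP; rewrite eqEsubset (gen_subG _ (Group wordsP)); apply/andP; split; apply/subsetP=> x.
  by rewrite !inE; apply: sub_words.
have gsG : all (mem <<[set x in gs]>>) gs by apply/allP=> g ggs; rewrite inE mem_gen ?inE.
rewrite inE; apply: (allP (@words_closed _ _ _ (mem <<_>>) _ _ gs gsG)); first exact: group1.
exact: groupM.
Qed.

Lemma pcgs_card_gen (gT : finGroupType) d (gs : seq gT) :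
  gpcgs d gs = pc_relations mulg 1 [::] d gs && (#|<<[set x in gs]>>| == 2 ^ size d)%N.
Proof.
apply: andb_id2l => gsR; rewrite (gen_words gsR) cardsE -(size_pcgs gsR).
by rewrite -(size_words mulg 1 gs) (sameP card_uniqP eqP).
Qed.

Lemma pcgs_gen_setT (gT : finGroupType) d (gs : seq gT) : #|gT| = (2 ^ size d)%N ->
  gpcgs d gs <-> pc_relations mulg 1 [::] d gs /\ <<[set x in gs]>> = [set: gT].
Proof.
move=> cT; rewrite pcgs_card_gen -cT -cardsT.
split=> [/andP[-> /eqP cgs]|[-> ->]]; last by rewrite eqxx.
by split=> //; apply/eqP; rewrite eqEcard subsetT cgs leqnn.
Qed.

Lemma gen_cycles3 (gT : finGroupType) (z a b c : gT) (gs : seq gT) :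
    z \in <[a]> :|: <[b]> :|: <[c]> -> gs =i [:: z; a; b; c] ->
  <<[set x in gs]>> = <[a]> <*> <[b]> <*> <[c]>.
Proof.
have := subxx (<[a]> <*> <[b]> <*> <[c]>).
rewrite !join_subG !cycle_subG => /andP[/andP[aJ bJ] cJ] z_abc gsE.
have zJ : z \in <[a]> <*> <[b]> <*> <[c]>.
  by move: z_abc; rewrite !inE -orbA => /or3P[] /cycleP[i ->]; rewrite groupX.
apply/eqP; rewrite eqEsubset gen_subG !join_subG !cycle_subG.
rewrite !mem_gen ?inE ?gsE ?inE ?eqxx ?orbT // !andbT.
by apply/subsetP=> x; rewrite inE gsE !inE => /or4P[] /eqP->.
Qed.

(* Both groups have the multiplication table of the presentation. *)
Lemma pcgs_homg (gT hT : finGroupType) d (gs : seq gT) (hs : seq hT) :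
    gpcgs d gs -> pc_relations mulg 1 [::] d hs ->
  <<[set x in hs]>> \homg <<[set x in gs]>>.
Proof.
case/andP=> gsR gs_uniq hsR; rewrite (gen_words hsR).
have gs_tb := pc_relations_tabulates gsR; have hs_tb := pc_relations_tabulates hsR.
have size_hs : size (gwords hs) = size (gwords gs).
  by rewrite !size_words (size_pcgs hsR) (size_pcgs gsR).
pose f x := nth 1 (gwords hs) (index x (gwords gs)).
have fM : {in <<[set x in gs]>> &, {morph f : x y / x * y}}.
  move=> x y; rewrite (gen_words gsR) !inE /f => /(nthP 1)[i lti <-] /(nthP 1)[j ltj <-].
  have [ltij <-] := tabulates_mul gs_tb lti ltj; rewrite !index_uniq //.
  by rewrite -size_hs in lti ltj; have [_ ->] := tabulates_mul hs_tb lti ltj.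
apply/homgP; exists (Morphism fM); rewrite morphimEdom /= (gen_words gsR).
apply/setP=> y; rewrite inE; apply/imsetP/idP => [[x + ->]|/(nthP 1)[i lti <-]].
  by rewrite inE => x_gs; rewrite /= /f mem_nth // size_hs index_mem.
rewrite size_hs in lti; exists (nth 1 (gwords gs) i); first by rewrite inE mem_nth.
by rewrite /= /f index_uniq.
Qed.

Lemma pc_relations_C2xQ8 (gT : finGroupType) (z c b a : gT) :
  pc_relations mulg 1 [::] pc_C2xQ8 [:: z; c; b; a] <->
  [/\ c ^+ 2 = 1, a ^+ 2 = b ^- 2 & b ^+ 2 = b ^- 2] /\
  [/\ a^-1 * b * a = b^-1, a * c = c * a, b * c = c * b & z = b ^+ 2].
Proof.
rewrite /pc_relations /pc_step /= !mulg1 !andbT; split.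
  case/and4P=> /andP[/eqP z2 _] /andP[/eqP c2 _] /andP[/eqP b2 /andP[_ /eqP bc]].
  case/andP=> /eqP a2 /and3P[_ /eqP ac /eqP ba].
  have zV : z^-1 = z by apply/eqP; rewrite eq_invg_mul z2.
  rewrite !expgS !expg0 !mulg1 a2 b2 zV c2; do 2![split=> //].
  by rewrite -mulgA ba mulKg; apply/eqP; rewrite eq_sym eq_invg_mul mulgA b2 z2.
case=> [[c2 a2 b2V] [ba ac bc ->]]; have b2c : commute (b ^+ 2) c by apply/commute_sym/commuteX.
have b2a : commute (b ^+ 2) a by rewrite b2V -a2; apply/commute_sym/commuteX.
have b4 : b ^+ 2 ^+ 2 = 1 by rewrite [_ ^+ 2 ^+ 2]expg2 {1}b2V mulVg.
have b3 : b * b ^+ 2 = b^-1 by rewrite b2V expgS expg1 invMg mulKVg.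
have b2b : commute (b ^+ 2) b by apply/commute_sym/commuteX.
by rewrite -!expg2 b4 c2 a2 -b2V b2c b2a b2b -ac -bc b3 -ba !mulgA mulgV mul1g !eqxx.
Qed.

Lemma pc_relations_C4oD8 (gT : finGroupType) (z a c b : gT) :
  pc_relations mulg 1 [::] pc_C4oD8 [:: z; a; c; b] <->
  [/\ a ^+ 2 = 1, b ^+ 2 = 1, c ^+ 4 = 1 & z = c ^+ 2] /\
  [/\ a * c = c * a, b * c = c * b & c ^+ 2 = (b * a) ^+ 2].
Proof.
rewrite /pc_relations /pc_step /= !mulg1 !andbT; split.
  case/and4P=> /andP[/eqP z2 _] /andP[/eqP a2 /eqP za] /andP[/eqP c2 /andP[_ /eqP ac]].
  case/andP=> /eqP b2 /and3P[/eqP zb /eqP ab /eqP cb].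
  rewrite !expgS !expg0 !mulg1 a2 b2 c2 mulgA c2 z2; do 2![split=> //].
  by rewrite -mulgA (mulgA a) ab !mulgA b2 mul1g -za -mulgA a2 mulg1.
case=> [[a2 b2 c4 ->] [ac bc c2]].
have c2c (x : gT) : commute x c -> commute (c ^+ 2) x by move=> xc; apply/commute_sym/commuteX.
have ab : a * b = b * (a * c ^+ 2).
  by rewrite -(c2c a ac) c2 expg2 !mulgA -expg2 b2 mul1g -mulgA -expg2 a2 mulg1.
by rewrite -!expg2 -expgM a2 b2 c4 (c2c a) // (c2c b) // (c2c c) // ac -bc ab !eqxx.
Qed.

Section PresentedGroups.

Variable gT : finGroupType.
Hypothesis card_gT : #|gT| = 16.

Lemma isog_C2xQ8P : [set: gT] \isog [set: C2xQ8] <-> exists gs : seq gT, gpcgs pc_C2xQ8 gs.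
Proof.
have genP (a b c : gT) : <<[set x in [:: b ^+ 2; c; b; a]]>> = <[a]> <*> <[b]> <*> <[c]>.
  apply: (gen_cycles3 (z := b ^+ 2)) => [|x]; first by rewrite !inE mem_cycle orbT.
  by rewrite !inE; case: (x == a); case: (x == b); case: (x == c); rewrite ?orbT.
split=> [/isog_hom|[gs /pcgs_gen_setT[] // gsR]].
  rewrite (Grp_C2xQ8 [set: gT]%G) => /existsP[[[a b] c] /eqP[defG c2 ab bb ba ac bc]].
  exists [:: b ^+ 2; c; b; a]; apply/pcgs_gen_setT; rewrite // genP pc_relations_C2xQ8 ab.
  by split.
have := size_pcgs gsR; case: gs gsR => [|z [|c [|b [|a []]]]] //.
case/pc_relations_C2xQ8=> [[c2 ab bb] [ba ac bc ->]] _; rewrite genP => genG.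
have homG : [set: gT] \homg [set: C2xQ8].
  rewrite (Grp_C2xQ8 [set: gT]%G); apply/existsP; exists (a, b, c) => /=.
  by rewrite !xpair_eqE genG c2 ab ba ac bc !eqxx -bb !eqxx.
have cQ : #|[set: quaternion_gtype 8]| = 8 := @card_quaternion 3 isT.
by rewrite isogEcard homG /= !cardsT card_gT card_prod card_ord -cardsT cQ.
Qed.

Lemma isoGrp_C4oD8P :
  [set: gT] \isog Grp (a : b : c :
    a ^+ 2 = 1, b ^+ 2 = 1, c ^+ 4 = 1, a * c = c * a, b * c = c * b, c ^+ 2 = (b * a) ^+ 2) <->
  exists gs : seq gT, gpcgs pc_C4oD8 gs.
Proof.
have genP (rT : finGroupType) (a b c : rT) :
    <<[set x in [:: c ^+ 2; a; c; b]]>> = <[a]> <*> <[b]> <*> <[c]>.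
  apply: (gen_cycles3 (z := c ^+ 2)) => [|x]; first by rewrite !inE mem_cycle orbT.
  by rewrite !inE; case: (x == a); case: (x == b); case: (x == c); rewrite ?orbT.
split=> [isoG|[gs gsP]].
  have /existsP[[[a b] c] /eqP[defG a2 b2 c4 ac bc c2]] := @isoGrp_hom _ [set: gT]%G _ isoG.
  by exists [:: c ^+ 2; a; c; b]; apply/pcgs_gen_setT; rewrite // genP pc_relations_C4oD8.
have /pcgs_gen_setT[] // := gsP => gsR; have := size_pcgs gsR.
case: gs gsP gsR => [|z [|a [|c [|b []]]]] // gsP.
case/pc_relations_C4oD8=> [[a2 b2 c4 zE] [ac bc c2]] _; rewrite {}zE in gsP *.
rewrite genP => genG; apply: (@intro_isoGrp _ [set: gT]%G).
  by apply/existsP; exists (a, b, c); rewrite /= !xpair_eqE genG a2 b2 c4 ac bc c2 !eqxx.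
move=> rT H /existsP[[[x y] w] /eqP[defH x2 y2 w4 xw yw w2]].
rewrite /= -genG -defH -!genP; apply: pcgs_homg gsP _.
by apply/pc_relations_C4oD8.
Qed.

End PresentedGroups.

(** * Groups of order 2 ^ n *)

Lemma small_2group_DS (gT : finGroupType) n : 0 < n <= 3 -> #|gT| = (2 ^ n)%N -> DS gT.
Proof.
move=> le_n cT S cS T e eS; apply: cospectral_regular_iso eS (cayley_regular S).
  by rewrite cT; case: n le_n {cT} => [|[|[|[]]]].
exact: cayley_simple.
Qed.

Lemma Cay_DS16P (gT : finGroupType) : #|gT| = 16 ->
  Cay_DS gT <-> exists d (gs : seq gT), d \in unmated_groups16 /\ gpcgs d gs.
Proof.
move=> cT; split=> [cayT|[d [gs [dU gsP]]]]; last exact: unmated_Cay_DS cT dU gsP.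
have [d [gs [d16 gsP _]]] : exists d (gs : seq gT),
    [/\ d \in small_2groups 4, gpcgs d gs & [set: gT]%G =i gwords gs].
  by apply: small_2group_pcgs; rewrite // cardsT.
exists d, gs; split=> //; have := d16; rewrite mem_cat => /orP[dM|//].
case: (mated_not_Cay_DS (d := d) (gs := gs)) => //; first by rewrite mem_rcons inE dM orbT.
by rewrite cT (size_small_2group _ d16).
Qed.

Lemma large_2group_not_Cay_DS (gT : finGroupType) n :
  #|gT| = (2 ^ n)%N -> 5 <= n -> ~ Cay_DS gT.
Proof.
move=> cT le5n; rewrite -cardsT in cT.
have [K sKT cK] := sub_pgroup (isT : prime 2) cT le5n.
have [H sHK cH] := sub_pgroup (isT : prime 2) cK (isT : 4 <= 5).
have not_cay d (gs : seq gT) : d \in mated_groups -> gpcgs d gs -> ~ Cay_DS gT.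
  move=> dM gsP; apply: mated_not_Cay_DS gsP _ => //; rewrite -cardsT cT dvdn_exp2l //.
  have /allP/(_ d dM) : all (fun d => size d <= 5) mated_groups by [].
  by move/leq_trans; apply.
have [d [gs [d16 gsP gsH]]] := small_2group_pcgs (isT : 4 <= 4) cH.
have := d16; rewrite mem_cat => /orP[dM|dU].
  by apply: not_cay gsP; rewrite mem_rcons inE dM orbT.
have iKH : #|K : H| = 2 by rewrite -divgS // cK cH.
have [d' [gs' [d'M gs'P _]]] :=
  extensions_contain_pcgs unmated_groups16_extensions sHK iKH dU gsP gsH.
exact: not_cay d'M gs'P.
Qed.

Theorem theorem4p3 (gT : finGroupType) (n : nat) :
  (1 <= n)%N -> #|gT| = (2 ^ n)%N ->
  [/\ (n <= 3)%N -> DS gT,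
      n = 4 ->
        (Cay_DS gT <->
         [set: gT] \isog [set: C2xQ8] \/
         [set: gT] \isog Grp (a : b : c :
           a ^+ 2 = 1, b ^+ 2 = 1, c ^+ 4 = 1,
           a * c = c * a, b * c = c * b, c ^+ 2 = (b * a) ^+ 2))
    & (5 <= n)%N -> ~ Cay_DS gT].
Proof.
move=> n_gt0 cT; split=> [le3||]; first by apply: small_2group_DS cT; rewrite n_gt0.
  move=> n4; rewrite n4 in cT; rewrite isog_C2xQ8P // isoGrp_C4oD8P // Cay_DS16P //.
  split=> [[d [gs [+ gsP]]]|[] [gs gsP]].
  - by rewrite !inE => /orP[] /eqP <-; [left|right]; exists gs.
  - by exists pc_C2xQ8, gs.
  by exists pc_C4oD8, gs.
exact: large_2group_not_Cay_DS.
Qed.
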